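(* For every real number $q > 2$ there is a compact set $K \subset \mathbb{T}$ such that: (1) there is a non-zero Schwartz distribution $S$ on $\mathbb{T}$, supported by $K$, with $\widehat{S} \in \ell_q(\mathbb{Z})$, i.e. $\sum_{n\in\mathbb{Z}} |\widehat{S}(n)|^q < \infty$; (2) there is no non-zero finite complex Borel measure $\mu$ supported by $K$ with $\widehat{\mu} \in \ell_q(\mathbb{Z})$.
   Context: $\mathbb{T} = \mathbb{R}/2\pi\mathbb{Z}$ is the circle. For a Schwartz distribution (or measure) $S$ on $\mathbb{T}$, $\widehat{S}(n)$, $n \in \mathbb{Z}$, denotes its Fourier coefficients, so that $S \sim \sum_n \widehat{S}(n) e^{int}$. A distribution or measure is supported by a closed set $K$ if its support is contained in $K$. Measures are finite complex Borel measures. *)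

(* Defs.v *)
From HB Require Import structures.
From mathcomp Require Import all_boot all_order all_algebra generic_quotient.
From mathcomp Require Import complex.
From mathcomp Require Import all_classical all_reals all_analysis.

Set Implicit Arguments.
Unset Strict Implicit.
Unset Printing Implicit Defensive.

Import Order.TTheory GRing.Theory Num.Theory.
Import numFieldNormedType.Exports.

Local Open Scope quotient_scope.
Local Open Scope classical_set_scope.
Local Open Scope complex_scope.
Local Open Scope ring_scope.

Notation normc := ComplexField.Normc.normc.

Section Circle.
Context {R : realType}.

Definition circle_rel (x y : R) : bool :=
  (x - y) / (2 * pi) \is a Num.int.

Lemma circle_rel_refl : reflexive circle_rel.
Proof. by move=> x; rewrite /circle_rel subrr mul0r rpred0. Qed.

Lemma circle_rel_sym : symmetric circle_rel.
Proof. by move=> x y; rewrite /circle_rel -opprB mulNr rpredN. Qed.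

Lemma circle_rel_trans : transitive circle_rel.
Proof.
by move=> y x z xy yz; rewrite /circle_rel -(subrKA y) mulrDl rpredD.
Qed.

Definition circle_equiv : equiv_rel R :=
  EquivRel circle_rel circle_rel_refl circle_rel_sym circle_rel_trans.

End Circle.

Definition circle (R : realType) : Type :=
  quotient_topology {eq_quot (@circle_equiv R)}.

Definition circle_proj {R : realType} (t : R) : circle R := \pi_(circle R) t.

Lemma circle_projP (R : realType) (x y : R) :
  reflect (circle_proj x = circle_proj y) ((x - y) / (2 * pi) \is a Num.int).
Proof. exact: (@eqmodP _ (@circle_equiv R) x y). Qed.

Lemma circle_projK (R : realType) (x : circle R) : circle_proj (repr x) = x.
Proof. exact: reprK. Qed.

Definition expit {R : realType} (n : int) (x : circle R) : R[i] :=
  cos (n%:~R * repr x) +i* sin (n%:~R * repr x).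

Lemma periodic_intr (R : realType) (f : R -> R) (k : int) (t : R) :
  periodic f (pi *+ 2) -> f (t + k%:~R * (2 * pi)) = f t.
Proof.
move=> fp; rewrite mulr_natl; case: k => m.
  by rewrite -pmulrn mulr_natl periodicn.
rewrite NegzE mulrNz -pmulrn mulNr mulr_natl.
by rewrite -{2}(subrK (pi *+ 2 *+ m.+1) t) (periodicn fp).
Qed.

Lemma expit_proj (R : realType) (n : int) (t : R) :
  expit n (circle_proj t) = cos (n%:~R * t) +i* sin (n%:~R * t).
Proof.
have [k kE] : exists k : int, repr (circle_proj t) = t + k%:~R * (2 * pi).
  have /circle_projP/intrP[k kE] := circle_projK (circle_proj t); exists k.
  by rewrite -kE divfK ?(addrC t) ?subrK // mulf_neq0 ?gt_eqF ?pi_gt0.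
rewrite /expit; move: (repr _) kE => r ->.
rewrite mulrDr (mulrA n%:~R) -intrM.
by rewrite (periodic_intr _ _ (@cosD2pi R)) (periodic_intr _ _ (@sinD2pi R)).
Qed.

Section TestFunctions.
Context {R : realType}.
Implicit Types (phi : circle R -> R[i]) (n N : nat) (t : R).

Definition lift_Re phi t : R := complex.Re (phi (circle_proj t)).
Definition lift_Im phi t : R := complex.Im (phi (circle_proj t)).

Definition smooth phi : Prop := forall n t,
  derivable (derive1n n (lift_Re phi)) t 1 /\ derivable (derive1n n (lift_Im phi)) t 1.

Definition cderive n phi t : R[i] :=
  derive1n n (lift_Re phi) t +i* derive1n n (lift_Im phi) t.

Definition sup_cderive n phi : R := sup (range (fun t => normc (cderive n phi t))).

Definition tsupp phi : set (circle R) := closure [set x | phi x != 0].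

End TestFunctions.

(* A distribution is only meaningful on smooth arguments. *)
Record schwartz_distribution (R : realType) := SchwartzDistribution {
  dist_fun :> (circle R -> R[i]) -> R[i];
  dist_linear : forall (a : R[i]) phi psi, smooth phi -> smooth psi ->
    dist_fun (fun x => a * phi x + psi x) = a * dist_fun phi + dist_fun psi;
  dist_continuous : exists (C : R) (N : nat), forall phi, smooth phi ->
    normc (dist_fun phi) <= C * \sum_(n < N.+1) sup_cderive n phi }.

Section Distributions.
Context {R : realType}.
Implicit Type S : schwartz_distribution R.

Definition dist_nonzero S : Prop := exists2 phi, smooth phi & S phi != 0.

Definition dist_supp S : set (circle R) :=
  [set x | forall U, open U -> U x ->
    exists phi, [/\ smooth phi, tsupp phi `<=` U & S phi != 0]].

(* Normalised so that S = \sum_n dist_fourier S n * e^(int) for the pairing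
   phi |-> \int_T f phi dt between functions f and test functions. *)
Definition dist_fourier S (n : int) : R[i] := ((2 * pi)^-1)%:C * S (expit (- n)).

End Distributions.

Definition borel_circle (R : realType) := g_sigma_algebraType (@open (circle R)).

Section ChargeIntegral.
Context d (T : measurableType d) (R : realType).
Variable nu : {charge set T -> \bar R}.

Lemma hahn_pair : {PN : set T * set T | hahn_decomposition nu PN.1 PN.2}.
Proof.
by apply: cid; have [P [N PN]] := Hahn_decomposition nu; exists (P, N).
Qed.

(* Independent of the Hahn decomposition chosen in hahn_pair. *)
Definition charge_integral (f : T -> R) : R :=
  Rintegral (jordan_pos (projT2 hahn_pair)) setT f
  - Rintegral (jordan_neg (projT2 hahn_pair)) setT f.

End ChargeIntegral.

Record complex_measure (R : realType) := ComplexMeasure {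
  cmeas_Re : {charge set (borel_circle R) -> \bar R};
  cmeas_Im : {charge set (borel_circle R) -> \bar R} }.

Section ComplexMeasures.
Context {R : realType}.
Implicit Type mu : complex_measure R.

Definition cmeas mu (A : set (borel_circle R)) : R[i] :=
  fine (cmeas_Re mu A) +i* fine (cmeas_Im mu A).

Definition cmeas_nonzero mu : Prop := exists2 A, measurable A & cmeas mu A != 0.

(* |mu|(U) <> 0 is expressed by a Borel subset of U that mu charges. *)
Definition cmeas_supp mu : set (circle R) :=
  [set x | forall U : set (circle R), open U -> U x ->
    exists A : set (borel_circle R), [/\ measurable A, A `<=` U & cmeas mu A != 0]].

Definition cmeas_integral mu (f : borel_circle R -> R[i]) : R[i] :=
  (charge_integral (cmeas_Re mu) (fun x => complex.Re (f x))
   - charge_integral (cmeas_Im mu) (fun x => complex.Im (f x)))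
  +i* (charge_integral (cmeas_Re mu) (fun x => complex.Im (f x))
   + charge_integral (cmeas_Im mu) (fun x => complex.Re (f x))).

Definition cmeas_fourier mu (n : int) : R[i] :=
  ((2 * pi)^-1)%:C * cmeas_integral mu (expit (- n)).

End ComplexMeasures.

Definition ell_q {R : realType} (q : R) (a : int -> R[i]) : Prop :=
  (\esum_(n in [set: int]) (normc (a n) `^ q)%:E < +oo)%E.

(* Main.v *)
Require Import Defs.
From HB Require Import structures.
From mathcomp Require Import all_boot all_order all_algebra.
From mathcomp Require Import complex zify ring lra.
From mathcomp Require Import all_classical all_reals all_analysis.
From mathcomp Require Import measurable_realfun.

(* For |s| < 1 a Riesz product P_s = \prod_(j < N) (1 + s cos (M 5^j t)) concentrates
   where the average X of the cosines cos (M 5^j t) is bounded away from 0.  Its Fourier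
   coefficient at a sum of m distinct signed frequencies is (s / 2)^m.  Choosing
   nodes s_i of size a and real weights w_i of total mass 1 whose moments of orders
   1, ..., L vanish, the mixture F = \sum_i w_i P_(s_i) keeps this concentration, while
   all its nonconstant coefficients are O(a)^L.  The weights have size O(1)^L, so that
   for N of order L / a^2 the square of the L^2 norm of F is only O(1)^L with a constant
   independent of a: as q > 2, the l_q norm of F - 1 is small once a is.  A Chernoff bound
   in L^2 shows that F can be cut off smoothly where X < 2 c at a negligible cost.  An
   infinite product of such truncated mixtures with carriers of base frequency
   M = 1, 2, 3, ... converges to a distribution S with coefficients in l_q, supported by
   the set K where the k-th average of cosines is at least c for every k.

   If mu is a measure with coefficients in l_q, they tend to 0, and this property passes
   from mu to h mu for bounded Borel h: for trigonometric polynomials h directly, and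
   then for indicators of arcs and of Borel sets by dominated convergence.  Hence the
   positive and negative parts of Re mu and Im mu have coefficients tending to 0.
   For such a positive measure m on K, the integral of the k-th average of cosines,
   whose frequencies are at least k + 1, tends to 0, although it is at least c m(K);
   so m = 0. *)

Import Order.TTheory GRing.Theory Num.Theory.
Import numFieldNormedType.Exports.

Local Open Scope classical_set_scope.
Local Open Scope ring_scope.

Set Implicit Arguments.
Unset Strict Implicit.
Unset Printing Implicit Defensive.

(** The level c has to be the same at every stage: with levels c_k tending to 0, the bound c_k m(K)
    would not contradict the decay of the integrals, and positive Riesz products with a tending to 0
    and N of order a^-2 would already have small l_q norms. So a is frozen in terms of q, and
    smallness is obtained from L alone, through coefficients O(a)^L. The price is that the weights
    change sign, which is why the limit is a distribution and not a measure. The condition q > 2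
    pays for the growth of the L^2 norm: the q-th powers of the coefficients sum to at most the (q -
    2)-nd power of the largest one times the squared L^2 norm. At q = 2 the claim fails, as S would
    be a square-integrable density, hence a measure on K. Frequencies of different stages may
    overlap. A product f (F - 1) has small coefficients because those of F - 1 are tiny and sit at
    distinct frequencies, while f is C^2 and so has summable coefficients. This is why the base
    frequency may grow as slowly as k + 1. *)

Section RealDerivatives.
Context {R : realType}.
Implicit Types (f g : R -> R) (t : R).

Lemma is_derive1D f g t a b : is_derive t 1 f a -> is_derive t 1 g b ->
  is_derive t 1 (fun x => f x + g x) (a + b).
Proof. by move=> df dg; exact: is_deriveD. Qed.

Lemma is_derive1M f g t a b : is_derive t 1 f a -> is_derive t 1 g b ->
  is_derive t 1 (fun x => f x * g x) (a * g t + f t * b).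
Proof.
move=> df dg; rewrite addrC (mulrC a); exact: (is_deriveM df dg).
Qed.

Lemma is_derive1Z f t c a : is_derive t 1 f a ->
  is_derive t 1 (fun x => c * f x) (c * a).
Proof. by move=> df; exact: (is_deriveZ c df). Qed.

Lemma is_derive1_continuous f (f' : R -> R) : (forall t, is_derive t 1 f (f' t)) ->
  continuous f.
Proof.
move=> df t.
by have /derivable1_diffP/differentiable_continuous := @ex_derive _ _ _ _ _ _ _ (df t).
Qed.

End RealDerivatives.

(** * Normalised integrals over a period and phase-shifted cosines *)

Section Mean.
Context {R : realType}.
Implicit Types (f g : R -> R) (n k : int) (a b t : R).

Lemma twopi_gt0 : 0 < 2 * pi :> R.
Proof. by rewrite mulr_gt0 ?pi_gt0. Qed.

Definition mean f : R :=
  (2 * pi)^-1 * \int[lebesgue_measure]_(t in `[0, 2 * pi]) f t.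

Lemma continuous_integrable f (a b : R) : continuous f ->
  lebesgue_measure.-integrable `[a, b] (EFin \o f).
Proof.
move=> cf; apply: continuous_compact_integrable; first exact: segment_compact.
exact: continuous_subspaceT.
Qed.

Lemma eq_mean f g : f =1 g -> mean f = mean g.
Proof. by move=> fg; congr (_ * _); apply: eq_Rintegral => t _; exact: fg. Qed.

Lemma meanD f g : continuous f -> continuous g ->
  mean (fun t => f t + g t) = mean f + mean g.
Proof.
move=> cf cg; rewrite /mean RintegralD ?mulrDr//; exact: continuous_integrable.
Qed.

Lemma meanZ (a : R) f : continuous f -> mean (fun t => a * f t) = a * mean f.
Proof.
move=> cf; rewrite /mean RintegralZl.
- by rewrite mulrCA.
- exact: measurable_itv.
- exact: continuous_integrable.
Qed.

Lemma mean_cst a : mean (fun=> a) = a.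
Proof.
rewrite /mean Rintegral_cst//= lebesgue_measure_itv/= lte_fin twopi_gt0 /=.
by rewrite subr0 mulrC mulfK// gt_eqF ?twopi_gt0.
Qed.

Lemma le_mean f g : continuous f -> continuous g -> (forall t, f t <= g t) ->
  mean f <= mean g.
Proof.
move=> cf cg fg; rewrite /mean ler_pM2l ?invr_gt0 ?twopi_gt0//.
by apply: le_Rintegral => //; exact: continuous_integrable.
Qed.

Lemma mean_ge0 f : (forall t, 0 <= f t) -> 0 <= mean f.
Proof.
move=> f0; rewrite mulr_ge0 ?invr_ge0 ?(ltW twopi_gt0)//.
exact: Rintegral_ge0.
Qed.

Lemma meanN f : continuous f -> mean (fun t => - f t) = - mean f.
Proof.
move=> cf; rewrite -mulN1r -meanZ//.
by apply: eq_mean => t; rewrite mulN1r.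
Qed.

Lemma meanB f g : continuous f -> continuous g ->
  mean (fun t => f t - g t) = mean f - mean g.
Proof.
move=> cf cg; rewrite meanD ?meanN//.
by move=> t; apply: cvgN; exact: cg.
Qed.

Lemma normr_mean f g : continuous f -> continuous g ->
  (forall t, `|f t| <= g t) -> `|mean f| <= mean g.
Proof.
move=> cf cg fg; rewrite ler_norml -meanN//; apply/andP; split.
  apply: le_mean => // t; first by apply: cvgN; exact: cg.
  by have := fg t; rewrite ler_norml => /andP[].
by apply: le_mean => // t; have := fg t; rewrite ler_norml => /andP[].
Qed.

Lemma continuous_sumr (T : topologicalType) (I : Type) (s : seq I) (F : I -> T -> R) :
  (forall i, continuous (F i)) -> continuous (fun x => \sum_(i <- s) F i x).
Proof.
move=> cF; elim: s => [|i s ih] t.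
  by under eq_fun do rewrite big_nil; exact: cvg_cst.
by under eq_fun do rewrite big_cons; apply: cvgD; [exact: cF | exact: ih].
Qed.

Lemma mean_sum (I : Type) (s : seq I) (F : I -> R -> R) :
  (forall i, continuous (F i)) ->
  mean (fun t => \sum_(i <- s) F i t) = \sum_(i <- s) mean (F i).
Proof.
move=> cF; elim: s => [|i s ih].
  by rewrite big_nil -[RHS](mean_cst 0); apply: eq_mean => t; rewrite big_nil.
rewrite big_cons -ih -meanD//; last exact: continuous_sumr.
by apply: eq_mean => t; rewrite big_cons.
Qed.

Lemma mean_derive (F f : R -> R) : (forall t, is_derive t 1 F (f t)) ->
  continuous f -> F (2 * pi) = F 0 -> mean f = 0.
Proof.
move=> dF cf FE; rewrite /mean /Rintegral (@continuous_FTC2 _ f F) ?FE.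
- by rewrite subee//= mulr0.
- exact: twopi_gt0.
- exact: continuous_subspaceT.
- have cF := is_derive1_continuous dF.
  split=> [t _||]; first exact: ex_derive.
    exact: cvg_at_right_filter (cF 0).
  exact: cvg_at_left_filter (cF _).
- by move=> t _; rewrite derive1E; exact: derive_val.
Qed.

(** A phase replaces complex exponentials: phases 0 and pi / 2 give cos and - sin, differentiation
    adds pi / 2 to the phase, and products of waves are sums of waves. *)
Definition wave n (a t : R) : R := cos (n%:~R * t + a).

Lemma continuous_wave n a : continuous (wave n a).
Proof.
move=> t; have := @continuous_comp _ _ _ (fun x : R => n%:~R * x + a) (@cos R) t.
apply.
  by apply: cvgD; [apply: cvgMr; exact: cvg_id | exact: cvg_cst].
exact: continuous_cos.
Qed.

Lemma is_derive_wave n a t :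
  is_derive t 1 (wave n a) (n%:~R * wave n (a + pi / 2) t).
Proof.
rewrite /wave addrA cosDpihalf.
have d : is_derive t 1 (fun x => n%:~R * x + a) (n%:~R : R).
  by apply: is_derive_eq; rewrite addr0 -[LHS]/(_ * _) mulr1.
have := @is_derive1_comp _ cos _ t _ _ (is_derive_cos _) d.
by rewrite mulrC.
Qed.

Lemma normr_wave n a t : `|wave n a t| <= 1.
Proof. exact: cos_max. Qed.

Lemma wave_periodic n a t k : wave n a (t + k%:~R * (2 * pi)) = wave n a t.
Proof.
rewrite /wave mulrDr addrAC (mulrA n%:~R) -intrM.
exact: (periodic_intr _ _ (@cosD2pi R)).
Qed.

Lemma wave_mul n k a b t :
  wave n a t * wave k b t = (wave (n + k) (a + b) t + wave (n - k) (a - b) t) / 2.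
Proof.
rewrite /wave intrD intrB.
have -> : (n%:~R + k%:~R) * t + (a + b) = (n%:~R * t + a) + (k%:~R * t + b) by ring.
have -> : (n%:~R - k%:~R) * t + (a - b) = (n%:~R * t + a) - (k%:~R * t + b) by ring.
by move: (_ * t + a) (_ * t + b) => x y; rewrite cosD cosB; field.
Qed.

End Mean.

(** * Bessel's inequality and decay of Fourier coefficients *)

Section FourierCoefficients.
Context {R : realType}.
Implicit Types (f g : R -> R) (n k : int) (a b t : R).

Lemma continuous_mulr f g : continuous f -> continuous g ->
  continuous (fun t => f t * g t).
Proof. by move=> cf cg t; apply: cvgM; [exact: cf | exact: cg]. Qed.

Lemma continuous_addr f g : continuous f -> continuous g ->
  continuous (fun t => f t + g t).
Proof. by move=> cf cg t; apply: cvgD; [exact: cf | exact: cg]. Qed.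

Lemma continuous_scaler (c : R) f : continuous f -> continuous (fun t => c * f t).
Proof. by move=> cf t; apply: cvgMr; exact: cf. Qed.

Lemma wave_period n a : wave n a (2 * pi) = wave n a 0 :> R.
Proof. by rewrite -[RHS](wave_periodic n a 0 1) mul1r add0r. Qed.

Lemma wave_pihalf n a t : wave n (a + pi / 2) t = - wave n (a - pi / 2) t :> R.
Proof. by rewrite /wave !addrA cosDpihalf cosBpihalf. Qed.

Lemma mean_wave n a : n != 0 -> mean (wave n a : R -> R) = 0.
Proof.
move=> n0; have nR : n%:~R != 0 :> R by rewrite intr_eq0.
apply: (@mean_derive _ (fun t => n%:~R^-1 * wave n (a - pi / 2) t)).
- move=> t; have d := is_derive1Z n%:~R^-1 (is_derive_wave n (a - pi / 2) t).
  by rewrite -[wave n a t](mulKf nR) -{2}(subrK (pi / 2) a).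
- exact: continuous_wave.
- by rewrite wave_period.
Qed.

(** In a fixed phase the waves of frequencies n and - n are not orthogonal. The mean square of f - p
    plus that of the conjugate of p is still mean f^2 - 2 Sum + Sum, where Sum is the left-hand
    side. *)
Lemma Bessel f a (s : seq int) : continuous f -> uniq s ->
  \sum_(n <- s) mean (fun t => f t * wave n a t) ^+ 2 <= mean (fun t => f t ^+ 2).
Proof.
move=> cf us; pose c n := mean (fun t => f t * wave n a t).
pose p (b t : R) := \sum_(n <- s) c n * wave n b t.
have cp b : continuous (p b).
  by apply: continuous_sumr => n; apply: continuous_scaler; exact: continuous_wave.
have cM := continuous_mulr.
have fp : mean (fun t => f t * p a t) = \sum_(n <- s) c n ^+ 2.
  under eq_mean do rewrite mulr_sumr.
  rewrite mean_sum => [|n]; last first.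
    by apply: cM => //; apply: continuous_scaler; exact: continuous_wave.
  apply: eq_bigr => n _; under eq_mean do rewrite mulrCA.
  by rewrite meanZ//; apply: cM => //; exact: continuous_wave.
(* With the conjugate polynomial added, only the frequency differences survive. *)
have pp : mean (fun t => p a t * p a t + p (a - pi / 2) t * p (a - pi / 2) t)
    = \sum_(n <- s) c n ^+ 2.
  rewrite (@eq_mean _ _ (fun t => \sum_(n <- s) \sum_(k <- s)
      (c n * c k) * wave (n - k) 0 t)) => [|t]; last first.
    rewrite /p !big_distrl -big_split; apply: eq_bigr => n _ /=.
    rewrite !big_distrr -big_split; apply: eq_bigr => k _ /=.
    rewrite mulrACA [X in _ + X]mulrACA -mulrDr; congr (_ * _).
    rewrite /wave !addrA !cosBpihalf -cosB; congr cos.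
    by rewrite intrB; ring.
  rewrite mean_sum => [|n]; last first.
    by apply: continuous_sumr => k; apply: continuous_scaler; exact: continuous_wave.
  rewrite [LHS]big_seq [RHS]big_seq; apply: eq_bigr => n ns.
  rewrite mean_sum => [|k]; last by apply: continuous_scaler; exact: continuous_wave.
  rewrite (bigD1_seq n)//= big1 => [|k kn].
    rewrite addr0 subrr meanZ; last exact: continuous_wave.
    rewrite (@eq_mean _ _ (fun=> 1)) => [|t]; first by rewrite mean_cst mulr1.
    by rewrite /wave mul0r addr0 cos0.
  by rewrite meanZ ?mean_wave ?mulr0 ?subr_eq0 1?eq_sym//; exact: continuous_wave.
have : 0 <= mean (fun t => (f t - p a t) ^+ 2 + p (a - pi / 2) t ^+ 2).
  by apply: mean_ge0 => t; rewrite addr_ge0 ?sqr_ge0.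
rewrite (@eq_mean _ _ (fun t => (f t * f t + (- 2) * (f t * p a t)) +
    (p a t * p a t + p (a - pi / 2) t * p (a - pi / 2) t))) => [|t]; last by ring.
have c1 := cM _ _ cf cf; have c2 := cM _ _ cf (cp a).
have c3 := cM _ _ (cp a) (cp a).
have c4 := cM _ _ (cp (a - pi / 2)) (cp (a - pi / 2)).
rewrite meanD; [|by apply: continuous_addr => //; exact: continuous_scaler|exact: continuous_addr].
rewrite meanD ?meanZ ?fp ?pp//; last exact: continuous_scaler.
under [X in _ -> _ <= X]eq_mean do rewrite expr2.
rewrite -/(c _); lra.
Qed.

Definition weight n : R := if n == 0 then 1 else (n%:~R ^+ 2)^-1.

Lemma weight_ge0 n : 0 <= weight n.
Proof. by rewrite /weight; case: ifP => // _; rewrite invr_ge0 sqr_ge0. Qed.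

(** The subtracted term makes the induction work: 1 / (x + 1)^2 <= 1 / x - 1 / (x + 1)
    telescopes. *)
Lemma sum_weight_nat (D : nat) : \sum_(i < D.+1) weight i.+1 <= 2 - D.+1%:R^-1.
Proof.
elim: D => [|D ih]; first by rewrite big_ord1 /weight/= expr1n invr1; lra.
rewrite big_ord_recr/=; apply: (le_trans (lerD ih (lexx _))).
rewrite /weight/= -pmulrn -[D.+2%:R]natr1.
set x : R := D.+1%:R; have x0 : 0 < x by rewrite ltr0n.
have x10 : 0 < x + 1 by rewrite addr_gt0.
rewrite -subr_ge0.
have -> : 2 - (x + 1)^-1 - (2 - x^-1 + ((x + 1) ^+ 2)^-1) =
   (x * (x + 1) ^+ 2)^-1 by field; rewrite !gt_eqF.
by rewrite invr_ge0 mulr_ge0 ?sqr_ge0// ltW.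
Qed.

Lemma weightN n : weight (- n) = weight n.
Proof. by rewrite /weight oppr_eq0 mulrNz sqrrN. Qed.

(** The constant is 1 for frequency 0 and 2 for each sign. *)
Lemma sum_weight (s : seq int) : uniq s -> \sum_(n <- s) weight n <= 5.
Proof.
move=> us; pose D := \max_(n <- s) `|n|%N.
pose r := [seq (i.+1 : int) | i <- iota 0 D.+1].
pose t : seq int := 0 :: r ++ map -%R r.
have memr (m : nat) : (m < D)%N -> (m.+1 : int) \in r.
  by move=> mD; apply/mapP; exists m; rewrite // mem_iota; lia.
have st : {subset s <= t}.
  move=> n ns; have : (`|n| <= D)%N by apply: leq_bigmax_seq.
  rewrite in_cons mem_cat; case: n ns => [[|m]|m] _ mD; first by rewrite eqxx.
    by rewrite memr ?orbT.
  by rewrite NegzE (mem_map (@oppr_inj _)) memr ?orbT.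
have wr : \sum_(n <- r) weight n <= 2.
  rewrite big_map -[D.+1]subn0 -/(index_iota 0 D.+1) big_mkord.
  by apply: (le_trans (sum_weight_nat D)); rewrite lerBlDr lerDl invr_ge0.
have ut : uniq t.
  rewrite cons_uniq mem_cat cat_uniq (map_inj_uniq (@oppr_inj _)).
  have ur : uniq r by rewrite map_inj_uniq ?iota_uniq// => i j [].
  rewrite ur andbT; apply/andP; split.
    apply/norP; split; first by apply/mapP => -[].
    by apply/mapP => -[k] /mapP[i _ ->].
  by apply/hasPn => _ /mapP[k /mapP[i _ ->] ->]; apply/mapP => -[].
have -> : \sum_(n <- s) weight n = \sum_(n <- t | n \in s) weight n.
  rewrite -[RHS]big_filter; apply: perm_big; apply: uniq_perm => //.
    exact: filter_uniq.
  by move=> n; rewrite mem_filter; case: (boolP (n \in s)) => // /st ->.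
apply: (@le_trans _ _ (\sum_(n <- t) weight n)).
  rewrite [leRHS](bigID (mem s))/= lerDl; apply: sumr_ge0 => n _.
  exact: weight_ge0.
rewrite big_cons big_cat [X in _ + (_ + X)]big_map/=.
under [X in _ + (_ + X)]eq_bigr do rewrite weightN.
by rewrite {1}/weight eqxx; move: wr; lra.
Qed.

(* f2 need not be periodic: two integrations by parts only see f and f1 at the end points. *)
Definition C2 b f : Prop := exists f1 f2 : R -> R,
  [/\ forall t, is_derive t 1 f (f1 t), forall t, is_derive t 1 f1 (f2 t),
      continuous f2, f (2 * pi) = f 0 /\ f1 (2 * pi) = f1 0
    & forall t, [/\ `|f t| <= b, `|f1 t| <= b & `|f2 t| <= b]].

Lemma C2_continuous b f : C2 b f -> continuous f.
Proof. by move=> [f1 [f2 [df _ _ _ _]]]; exact: is_derive1_continuous df. Qed.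

Lemma C2_bounded b f t : C2 b f -> `|f t| <= b.
Proof. by move=> [f1 [f2 [_ _ _ _ /(_ t)[]]]]. Qed.

Lemma C2_ge0 b f : C2 b f -> 0 <= b.
Proof. by move=> /(C2_bounded 0); apply: le_trans. Qed.

(** The factor 4 = 1 + 2 + 1 comes from the Leibniz rule for the second derivative. *)
Lemma C2M a b f g : C2 a f -> C2 b g -> C2 (4 * a * b) (fun t => f t * g t).
Proof.
move=> [f1 [f2 [df df1 cf2 [pf pf1] bf]]] [g1 [g2 [dg dg1 cg2 [pg pg1] bg]]].
have cf := is_derive1_continuous df; have cf1 := is_derive1_continuous df1.
have cg := is_derive1_continuous dg; have cg1 := is_derive1_continuous dg1.
exists (fun t => f1 t * g t + f t * g1 t).
exists (fun t => (f2 t * g t + f1 t * g1 t) + (f1 t * g1 t + f t * g2 t)).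
have b0 (x y c d : R) : `|x| <= c -> `|y| <= d -> `|x * y| <= c * d.
  by move=> xc yd; rewrite normrM ler_pM.
split.
- by move=> t; exact: is_derive1M.
- by move=> t; apply: is_derive1D; exact: is_derive1M.
- by do 2 apply: continuous_addr; exact: continuous_mulr.
- by rewrite pf pf1 pg pg1.
- move=> t; have [f0 f1b f2b] := bf t; have [g0 g1b g2b] := bg t.
  have ab0 : 0 <= a * b by rewrite mulr_ge0// (le_trans _ f0, le_trans _ g0).
  have tri (x y c d : R) : `|x| <= c -> `|y| <= d -> `|x + y| <= c + d.
    by move=> xc yd; apply: (le_trans (ler_normD _ _)); exact: lerD.
  split.
  + by apply: (le_trans (b0 _ _ _ _ f0 g0)); lra.
  + by apply: (le_trans (tri _ _ _ _ (b0 _ _ _ _ f1b g0) (b0 _ _ _ _ f0 g1b))); lra.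
  + apply: (le_trans (tri _ _ _ _ (tri _ _ _ _ (b0 _ _ _ _ f2b g0) (b0 _ _ _ _ f1b g1b))
     (tri _ _ _ _ (b0 _ _ _ _ f1b g1b) (b0 _ _ _ _ f0 g2b)))); lra.
Qed.

Lemma C2_coef b f n a : C2 b f -> `|mean (fun t => f t * wave n a t)| <= b * weight n.
Proof.
move=> Cf; rewrite /weight; have [->|n0] := eqVneq.
  rewrite mulr1 -[leRHS]mean_cst; apply: normr_mean.
  - exact: continuous_mulr (C2_continuous Cf) (@continuous_wave _ _ _).
  - by move=> t; exact: cvg_cst.
  - move=> t; rewrite normrM -[b]mulr1 ler_pM ?normr_wave//.
    exact: C2_bounded Cf.
have cf := C2_continuous Cf.
move: Cf => [f1 [f2 [df df1 cf2 [pf pf1] bf]]].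
have cw := @continuous_wave R n.
have nR : n%:~R != 0 :> R by rewrite intr_eq0.
pose N : R := n%:~R^-1.
(* One explicit primitive performs both integrations by parts: the two terms in f1 cancel because
   phases a + pi / 2 and a - pi / 2 differ by a sign. *)
have : mean (fun t => f t * wave n a t + N ^+ 2 * (f2 t * wave n a t)) = 0.
  apply: (@mean_derive _ (fun t => N * (f t * wave n (a - pi / 2) t) +
    N ^+ 2 * (f1 t * wave n a t))).
  - move=> t.
    have d := is_derive1D
      (is_derive1Z N (is_derive1M (df t) (is_derive_wave n (a - pi / 2) t)))
      (is_derive1Z (N ^+ 2) (is_derive1M (df1 t) (is_derive_wave n a t))).
    apply: (is_derive_eq d).
    rewrite subrK wave_pihalf /N; field.
    by [].
  - apply: continuous_addr; first exact: continuous_mulr.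
    by apply: continuous_scaler; exact: continuous_mulr.
  - by rewrite pf pf1 !wave_period.
have cM : continuous (fun t => f2 t * wave n a t) by exact: continuous_mulr.
rewrite meanD; [|exact: continuous_mulr|exact: continuous_scaler].
rewrite meanZ// => /eqP; rewrite addr_eq0 => /eqP ->.
rewrite normrN normrM [leRHS]mulrC -exprVn ger0_norm ?sqr_ge0//.
apply: ler_wpM2l; first exact: sqr_ge0.
rewrite -[leRHS]mean_cst; apply: normr_mean => //.
  by move=> t; exact: cvg_cst.
move=> t; rewrite normrM -[b]mulr1 ler_pM ?normr_wave//.
by case: (bf t).
Qed.

Definition trig_sum (I : Type) (T : seq I) (c : I -> R) (l : I -> int) (t : R) : R :=
  \sum_(i <- T) c i * wave (l i) 0 t.

Lemma continuous_trig_sum (I : Type) (T : seq I) c l : continuous (@trig_sum I T c l).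
Proof.
by apply: continuous_sumr => i; apply: continuous_scaler; exact: continuous_wave.
Qed.

(** The coefficients of f are summable with total at most 5 b, and distinct frequencies meet each of
    them at most once per sign. The bound is thus independent of the number of terms. *)
Lemma trig_sum_coef (I : Type) (T : seq I) (c : I -> R) (l : I -> int)
    (sigma b : R) f n a :
  uniq (map l T) -> 0 <= sigma -> (forall i, `|c i| <= sigma) -> C2 b f ->
  `|mean (fun t => f t * trig_sum T c l t * wave n a t)| <= sigma * (5 * b).
Proof.
move=> uT s0 cs Cf; have cf := C2_continuous Cf.
have b0 := C2_ge0 Cf.
pose F i t := 2^-1 * c i * (f t * wave (l i + n) a t + f t * wave (l i - n) (- a) t).
have cF i : continuous (F i).
  apply: continuous_scaler.
  by apply: continuous_addr; apply: continuous_mulr => //; exact: continuous_wave.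
rewrite (@eq_mean _ _ (fun t => \sum_(i <- T) F i t)) => [|t]; last first.
  rewrite mulr_sumr mulr_suml; apply: eq_bigr => i _; rewrite /F -mulrDr.
  rewrite -[a in RHS]add0r -[- (0 + a)]add0r opprD oppr0 add0r.
  have := wave_mul (l i) n 0 a t; rewrite add0r sub0r => e.
  transitivity (c i * f t * (wave (l i) 0 t * wave n a t)); first by ring.
  by rewrite e add0r; field.
rewrite mean_sum//; apply: (le_trans (ler_norm_sum _ _ _)).
have step i : `|mean (F i)| <= 2^-1 * sigma * b * (weight (l i + n) + weight (l i - n)).
  have cm m d : continuous (fun t => f t * wave m d t).
    by apply: continuous_mulr => //; exact: continuous_wave.
  rewrite /F meanZ ?meanD//; last exact: continuous_addr.
  rewrite !normrM ger0_norm ?invr_ge0//; rewrite -!mulrA ler_pM2l ?invr_gt0//.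
  apply: ler_pM => //.
  apply: (le_trans (ler_normD _ _)); rewrite mulrDr.
  by apply: lerD; exact: C2_coef.
apply: (@le_trans _ _ (\sum_(i <- T) 2^-1 * sigma * b *
    (weight (l i + n) + weight (l i - n)))).
  by apply: ler_sum => i _; exact: step.
rewrite -mulr_sumr big_split/=.
have w (m : int) : \sum_(i <- T) weight (l i + m) <= 5.
  rewrite -(big_map l xpredT (fun x => weight (x + m))).
  rewrite -(big_map (fun x => x + m) xpredT weight).
  by apply: sum_weight; rewrite map_inj_uniq//; exact: addIr.
have := lerD (w n) (w (- n)).
have : 0 <= 2^-1 * sigma * b by rewrite !mulr_ge0 ?invr_ge0.
move=> /ler_wpM2l h /h /le_trans; apply.
by rewrite le_eqVlt; apply/orP; left; apply/eqP; field.
Qed.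

End FourierCoefficients.

(** * Lacunary products: means and frequency expansion *)

Section RieszProducts.
Context {R : realType}.
Implicit Types (f g : R -> R) (n k : int) (a b s t : R).

Definition band_limited (D : nat) f : Prop :=
  continuous f /\
  forall n a, (D < `|n|)%N -> mean (fun t => f t * wave n a t) = 0.

Lemma band_limited1 : band_limited 0 (fun=> 1).
Proof.
split=> [t|n a n0]; first exact: cvg_cst.
by under eq_mean do rewrite mul1r; rewrite mean_wave// -absz_gt0.
Qed.

Lemma band_limitedS (D E : nat) f : (D <= E)%N -> band_limited D f -> band_limited E f.
Proof. by move=> DE [cf f0]; split=> // n a /(leq_ltn_trans DE); exact: f0. Qed.

Lemma band_limited_sum D (I : Type) (r : seq I) (F : I -> R -> R) :
  (forall i, band_limited D (F i)) ->
  band_limited D (fun t => \sum_(i <- r) F i t).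
Proof.
move=> FD; split; first by apply: continuous_sumr => i; case: (FD i).
move=> n a nD; under eq_mean do rewrite mulr_suml.
rewrite mean_sum => [|i].
  by apply: big1 => i _; case: (FD i) => _; exact.
by apply: continuous_mulr; [case: (FD i) | exact: continuous_wave].
Qed.

Lemma band_limitedZ D c f : band_limited D f -> band_limited D (fun t => c * f t).
Proof.
move=> [cf f0]; split=> [|n a nD]; first exact: continuous_scaler.
under eq_mean do rewrite -mulrA.
rewrite meanZ ?f0 ?mulr0//; exact: continuous_mulr (@continuous_wave _ _ _).
Qed.

Lemma band_limited_wave (D E : nat) k b f : (D + `|k| <= E)%N -> band_limited D f ->
  band_limited E (fun t => f t * wave k b t).
Proof.
move=> DE [cf f0]; split=> [|n a nE].
  exact: continuous_mulr (@continuous_wave _ _ _).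
have cw m c : continuous (fun t => f t * wave m c t).
  exact: continuous_mulr (@continuous_wave _ _ _).
rewrite (@eq_mean _ _ (fun t => 2^-1 * (f t * wave (k + n) (b + a) t +
    f t * wave (k - n) (b - a) t))) => [|t]; last first.
  by rewrite -mulrA wave_mul; field.
rewrite meanZ ?meanD ?f0 ?addr0 ?mulr0//; try lia.
exact: continuous_addr.
Qed.

Lemma mean_band_limited D f : band_limited D f ->
  forall n a, (D < `|n|)%N -> mean (fun t => f t * wave n a t) = 0.
Proof. by case. Qed.

(* Base 5 beats the degree 4 of the factors, making them independent. *)
Definition carrier (M j : nat) : R -> R := wave (M * 5 ^ j)%N 0.

(** The product of the first n factors has frequencies up to M (5^n - 1), below every positive
    frequency d M 5^n of the next factor, so only its constant term [A 0] contributes. Adding 4 M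
    5^n reproduces the bound for n + 1. *)
Lemma mean_prod (M N : nat) (A : nat -> R) (p : R -> R) : (0 < M)%N ->
  (forall x, p (cos x) = \sum_(d < 5) A d * cos (d%:R * x)) ->
  continuous (fun t => \prod_(j < N) p (carrier M j t)) /\
  mean (fun t => \prod_(j < N) p (carrier M j t)) = A 0 ^+ N.
Proof.
move=> M0 pA; pose Q (n : nat) t := \prod_(j < n) p (carrier M j t).
have pE j t : p (carrier M j t) =
    \sum_(d < 5) A d * wave (d * (M * 5 ^ j))%N 0 t.
  rewrite /carrier /wave addr0 pA; apply: eq_bigr => d _; congr (_ * cos _).
  by rewrite addr0 [in RHS]PoszM intrM mulrA.
have QE (n : nat) : Q n.+1 = fun t => \sum_(d < 5)
    A d * (Q n t * wave (d * (M * 5 ^ n))%N 0 t).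
  apply/funext => t; rewrite /Q big_ord_recr/= pE mulr_sumr.
  by apply: eq_bigr => d _; rewrite mulrCA.
have QD (n : nat) : band_limited (M * (5 ^ n - 1)) (Q n) /\ mean (Q n) = A 0 ^+ n.
  elim: n => [|n [ih mih]].
    have -> : Q 0%N = fun=> 1 by apply/funext => t; rewrite /Q big_ord0.
    by rewrite mean_cst expr0; split=> //; exact: band_limitedS band_limited1.
  have n5 : (0 < 5 ^ n)%N by rewrite expn_gt0.
  rewrite QE; split.
    apply: band_limited_sum => d; apply: band_limitedZ.
    apply: band_limited_wave ih; rewrite absz_nat expnS.
    by have := ltn_ord d; case: (nat_of_ord d) => [|[|[|[|[|]]]]]//= _; nia.
  have cQ m : continuous (fun t => Q n t * wave m 0 t).
    by apply: continuous_mulr; [case: ih | exact: continuous_wave].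
  rewrite mean_sum => [|d]; last exact: continuous_scaler.
  rewrite big_ord_recl/= big1 => [|d _].
    rewrite addr0 meanZ// exprS -mih; congr (_ * _); apply: eq_mean => t.
    by rewrite mul0n /wave mul0r addr0 cos0 mulr1.
  rewrite meanZ// (mean_band_limited ih) ?mulr0// absz_nat /bump/=; nia.
by have [[cQ _] mQ] := QD N.
Qed.

Definition shift_term k (x : nat * int) : nat * int := (x.1.+1, x.2 + k).

(* x.1 is the number of carriers involved and x.2 the resulting frequency. *)
Fixpoint riesz_terms (M N : nat) : seq (nat * int) :=
  if N is N'.+1 then
    riesz_terms M N' ++
    ([seq shift_term (M * 5 ^ N')%N x | x <- riesz_terms M N'] ++
     [seq shift_term (- (M * 5 ^ N')%N%:Z) x | x <- riesz_terms M N'])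
  else [:: (0%N, 0 : int)].

Lemma riesz_expansion (M N : nat) s t :
  \prod_(j < N) (1 + s * carrier M j t) =
  \sum_(x <- riesz_terms M N) (s / 2) ^+ x.1 * wave x.2 0 t.
Proof.
elim: N => [|N ih].
  by rewrite big_ord0 big_seq1 expr0 mul1r /wave mul0r addr0 cos0.
rewrite big_ord_recr/= ih mulrDr mulr1 !big_cat !big_map/=; congr (_ + _).
rewrite mulr_suml -big_split/=; apply: eq_bigr => x _.
rewrite /carrier mulrACA.
rewrite wave_mul addr0 subr0 exprSr.
by field.
Qed.

(** The extreme frequency is the geometric sum M (5^N - 1) / 4. Staying below a quarter of the next
    carrier keeps the three blocks of [riesz_terms] disjoint. *)
Lemma riesz_terms_bound (M N : nat) (x : nat * int) : (0 < M)%N -> x \in riesz_terms M N ->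
  (4 * `|x.2| < M * 5 ^ N)%N.
Proof.
move=> M0; elim: N x => [|N ih] x /=.
  by rewrite inE => /eqP -> /=; rewrite muln0 muln1.
rewrite !mem_cat => /or3P[/ih h|/mapP[y /ih h ->]|/mapP[y /ih h ->]] /=;
  rewrite expnS mulnCA; move: (M * 5 ^ N)%N h => K h; lia.
Qed.

Lemma riesz_terms_uniq (M N : nat) : (0 < M)%N -> uniq (map snd (riesz_terms M N)).
Proof.
move=> M0; elim: N => //= N ih.
have n5 : (0 < 5 ^ N)%N by rewrite expn_gt0.
have Mn : (0 < M * 5 ^ N)%N by rewrite muln_gt0 M0.
have bd (x : nat * int) : x \in riesz_terms M N -> (4 * `|x.2| < M * 5 ^ N)%N.
  exact: riesz_terms_bound.
rewrite !map_cat -!map_comp/=.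
have mc (c : int) : [seq (snd \o shift_term c) x
    | x <- riesz_terms M N] = [seq y + c | y <- map snd (riesz_terms M N)].
  by rewrite -map_comp.
have ui (c : int) : uniq [seq y + c | y <- map snd (riesz_terms M N)].
  by rewrite map_inj_uniq//; exact: addIr.
rewrite !mc !cat_uniq ih !ui/= andbT; apply/andP; split.
  apply/hasPn => z; rewrite mem_cat => /orP[] /mapP[y /mapP[x /bd xb ->] ->];
    apply/negP => /mapP[u /bd ub]; lia.
by apply/hasPn => z /mapP[y /mapP[x /bd xb ->] ->];
  apply/negP => /mapP[u /mapP[v /bd ub ->]]; lia.
Qed.

(** Isolates the constant term, so that [behead] later leaves exactly the terms using at least one
    carrier. *)
Lemma riesz_terms_head (M N : nat) : exists2 T, riesz_terms M N = (0%N, 0) :: T &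
  all (fun x => 0 < x.1)%N T.
Proof.
elim: N => [|N [T TE Tp]] /=; first by exists [::].
exists (T ++ (map (shift_term (M * 5 ^ N)%N) (riesz_terms M N) ++
  map (shift_term (- (M * 5 ^ N)%N%:Z)) (riesz_terms M N))).
  by rewrite {1}TE.
rewrite all_cat Tp/= all_cat; apply/andP; split;
  by apply/allP => _ /mapP[x _ ->].
Qed.

End RieszProducts.

(** * Nodes and weights with vanishing moments *)

Section Moments.
Context {R : realType}.

Lemma coef_norm_mulXsubC (p : {poly R}) (b : R) (n : nat) :
  \sum_(i < n.+1) `|(p * ('X - b%:P))`_i| <= (1 + `|b|) * \sum_(i < n.+1) `|p`_i|.
Proof.
apply: (@le_trans _ _ (\sum_(i < n.+1) (`|(p * 'X)`_i| + `|b| * `|p`_i|))).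
  apply: ler_sum => i _; rewrite mulrBr coefB coefMC.
  by rewrite (le_trans (ler_normB _ _))// [X in _ + X <= _]normrM [X in _ + X <= _]mulrC.
rewrite big_split/= -mulr_sumr mulrDl mul1r lerD2r big_ord_recl coefMX eqxx normr0 add0r.
rewrite [leRHS]big_ord_recr/=.
under eq_bigr do rewrite coefMX/=.
by rewrite lerDl.
Qed.

Lemma coef_norm_prodXsubC (s : seq R) (n : nat) : (forall b, b \in s -> `|b| <= 1) ->
  \sum_(i < n.+1) `|(\prod_(b <- s) ('X - b%:P))`_i| <= 2 ^+ size s.
Proof.
elim: s => [_|b s ih sb].
  rewrite big_nil expr0 big_ord_recl coef1/= normr1 big1 ?addr0// => i _.
  by rewrite coef1/= normr0.
rewrite big_cons mulrC exprS; apply: (le_trans (coef_norm_mulXsubC _ _ _)).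
apply: ler_pM; first by rewrite addr_ge0.
- exact: sumr_ge0.
- by rewrite -[2]/(1 + 1) lerD2l sb ?mem_head.
- by apply: ih => c cs; rewrite sb// in_cons cs orbT.
Qed.

(** Each step of the induction costs (1 + 1 / L)^L <= e. This keeps the growth of the weights
    exponential in L. *)
Lemma expn_le_fact (L : nat) : L%:R ^+ L <= expR 1 ^+ L * L`!%:R :> R.
Proof.
elim: L => [|L ih]; first by rewrite !expr0 mulr1.
have [->|L0] := posnP L; first by rewrite !expr1 mulr1 ltW// expR_gt1.
have LR : 0 < L%:R :> R by rewrite ltr0n.
have step : L.+1%:R ^+ L <= expR 1 * L%:R ^+ L :> R.
  have -> : L.+1%:R = (1 + L%:R^-1) * L%:R :> R.
    by rewrite mulrDl mul1r mulVf ?gt_eqF// natr1.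
  rewrite exprMn ler_pM2r ?exprn_gt0//.
  have -> : expR 1 = expR L%:R^-1 ^+ L :> R by rewrite -expRM_natl mulfV ?gt_eqF.
  by rewrite lerXn2r ?nnegrE ?expR_ge0 ?expR_ge1Dx// addr_ge0// invr_ge0 ltW.
rewrite exprS factS natrM [leRHS]mulrCA; apply: ler_wpM2l => //.
apply: (le_trans step); rewrite [in leRHS]exprS -mulrA.
by apply: ler_wpM2l; rewrite ?expR_ge0.
Qed.

(* The nodes are the powers of theta, so that the moment of order m is the value at
   theta ^ m of a polynomial vanishing at theta, ..., theta ^ L. *)
Lemma vanishing_moments (L : nat) : (0 < L)%N -> exists w s : nat -> R,
  [/\ forall i, (i <= L)%N -> 2^-1 <= s i <= 1,
      \sum_(i < L.+1) w i = 1,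
      forall m, (0 < m <= L)%N -> \sum_(i < L.+1) w i * s i ^+ m = 0
    & \sum_(i < L.+1) `|w i| <= (8 * expR 1) ^+ L].
Proof.
move=> L0; have LR : 0 < L%:R :> R by rewrite ltr0n.
(* By Bernoulli's inequality this ratio keeps all powers up to L above 1 / 2, while each step still
   moves away from 1 by at least 1 / (4 L). *)
pose th : R := 1 - (2 * L%:R)^-1.
have e0 : 0 < (2 * L%:R)^-1 :> R by rewrite invr_gt0 mulr_gt0.
have e1 : (2 * L%:R)^-1 <= 2^-1 :> R.
  by rewrite lef_pV2 ?posrE ?mulr_gt0// ler_peMr// ler1n.
have th0 : 0 <= th by rewrite /th; lra.
have th1 : th <= 1 by rewrite /th; lra.
have thX i : th ^+ i <= 1 by exact: exprn_ile1.
have thL (i : nat) : 1 - i%:R * (2 * L%:R)^-1 <= th ^+ i.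
  elim: i => [|i ih]; first by rewrite expr0 mul0r subr0.
  have x1 := thX i; rewrite exprSr -natr1 {2}/th; move: ih x1 e0.
  set x := th ^+ i; set e := _^-1 => ih x1 e_gt0.
  by have := mulr_ge0 (ltW e_gt0) (_ : 0 <= 1 - x); rewrite subr_ge0 => /(_ x1); lra.
have th2 (i : nat) : (i <= L)%N -> 2^-1 <= th ^+ i.
  move=> iL; apply: le_trans (thL i).
  have : i%:R * (2 * L%:R)^-1 <= 2^-1 :> R.
    rewrite invfM mulrCA -[leRHS]mulr1 ler_pM2l ?invr_gt0//.
    by rewrite ler_pdivrMr// mul1r ler_nat.
  lra.
have D1 (i : nat) : (i <= L)%N -> i%:R / (4 * L%:R) <= 1 - th ^+ i.
  elim: i => [|i ih] iL; first by rewrite expr0 subrr mul0r.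
  have h := ih (ltnW iL); have h2 := th2 _ (ltnW iL); move: h h2.
  rewrite exprSr -[i.+1%:R]natr1 {4}/th [(_ + 1) / _]mulrDl mul1r.
  have -> : (4 * L%:R)^-1 = 2^-1 * (2 * L%:R)^-1 :> R.
    by rewrite -[4%:R]/((2 * 2)%:R) natrM -mulrA invfM.
  move: e0; set x := th ^+ i; set e := (2 * _)^-1 => e_gt0 h h2.
  by have := mulr_ge0 (ltW e_gt0) (_ : 0 <= x - 2^-1); rewrite subr_ge0 => /(_ h2); lra.
pose bs := [seq th ^+ i.+1 | i <- iota 0 L].
pose P : {poly R} := \prod_(b <- bs) ('X - b%:P).
have PE x : P.[x] = \prod_(i < L) (x - th ^+ i.+1).
  rewrite /P big_map -{1}[L]subn0 -/(index_iota 0 L) big_mkord horner_prod.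
  by apply: eq_bigr => i _; rewrite hornerXsubC.
have sP : (size P <= L.+1)%N by rewrite size_prod_XsubC size_map size_iota.
have P1 : L`!%:R / (4 * L%:R) ^+ L <= P.[1].
  have -> n : n`!%:R / (4 * L%:R) ^+ n = \prod_(i < n) (i.+1%:R / (4 * L%:R)) :> R.
    elim: n => [|n ih]; first by rewrite big_ord0 expr0 divr1.
    by rewrite big_ord_recr/= -ih factS natrM exprS invfM mulrACA mulrC.
  rewrite PE; apply: ler_prod => i _; rewrite D1 ?ltn_ord// andbT.
  by rewrite divr_ge0// mulr_ge0.
have P1gt0 : 0 < P.[1].
  by apply: lt_le_trans P1; rewrite divr_gt0 ?ltr0n ?fact_gt0// exprn_gt0 ?mulr_gt0.
have moment m : \sum_(i < L.+1) (P`_i / P.[1]) * (th ^+ i) ^+ m = P.[th ^+ m] / P.[1].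
  rewrite (horner_coef_wide (th ^+ m) sP) mulr_suml; apply: eq_bigr => i _.
  by rewrite mulrAC -exprM mulnC exprM.
exists (fun i => P`_i / P.[1]), (fun i => th ^+ i); split.
- by move=> i iL; rewrite th2 ?thX.
- under eq_bigr do rewrite -[_ / _]mulr1.
  by have := moment 0%N; rewrite expr0 divff ?gt_eqF// => <-; under [RHS]eq_bigr do rewrite expr0.
- move=> [//|m] /andP[_ mL]; rewrite moment PE (bigD1 (Ordinal mL))//=.
  by rewrite subrr !mul0r.
- under eq_bigr do rewrite normrM normfV (ger0_norm (ltW P1gt0)).
  rewrite -mulr_suml ler_pdivrMr//.
  (* The roots of P lie in [0, 1], so its coefficients sum to at most 2^L in absolute value;
     dividing by P(1) >= L! / (4 L)^L leaves (8 e)^L. *)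
  apply: (@le_trans _ _ (2 ^+ L)).
    have := @coef_norm_prodXsubC bs L; rewrite size_map size_iota; apply.
    by move=> _ /mapP[i _ ->]; rewrite ger0_norm ?thX// exprn_ge0.
  have h : L`!%:R / (4 * L%:R) ^+ L * (8 * expR 1) ^+ L <= P.[1] * (8 * expR 1) ^+ L.
    by rewrite ler_wpM2r// exprn_ge0// mulr_ge0 ?expR_ge0.
  rewrite mulrC; apply: le_trans h.
  have LL : 0 < (4 * L%:R) ^+ L :> R by rewrite exprn_gt0// mulr_gt0.
  rewrite mulrAC ler_pdivlMr// -exprMn mulrA -natrM exprMn.
  rewrite [in leRHS]exprMn mulrCA ler_wpM2l ?exprn_ge0//.
  by rewrite mulrC expn_le_fact.
Qed.

End Moments.

(** * Pointwise inequalities and exact means for one Riesz product *)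

Section RieszMixture.
Context {R : realType}.
Implicit Types (a s t x y : R).

(** Cauchy-Schwarz for the measure |w|, by symmetrising the double sum. *)
Lemma sqr_sum_le (n : nat) (w x : 'I_n -> R) :
  (\sum_i w i * x i) ^+ 2 <= (\sum_i `|w i|) * \sum_i `|w i| * x i ^+ 2.
Proof.
pose A := \sum_i `|w i|; pose B := \sum_i `|w i| * x i ^+ 2.
apply: (@le_trans _ _ (\sum_i \sum_j
    2^-1 * (`|w i| * `|w j|) * (x i ^+ 2 + x j ^+ 2))).
  rewrite expr2 mulr_suml; apply: ler_sum => i _.
  rewrite mulr_sumr; apply: ler_sum => j _.
  apply: (le_trans (ler_norm _)); rewrite mulrACA normrM [`|w i * _|]normrM.
  rewrite [2^-1 * _]mulrC -[leRHS]mulrA; apply: ler_wpM2l; first by rewrite mulr_ge0.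
  rewrite normrM -(real_normK (num_real (x i))) -(real_normK (num_real (x j))).
  by have := sqr_ge0 (`|x i| - `|x j|); nra.
rewrite le_eqVlt; apply/orP; left; apply/eqP.
have -> : \sum_i \sum_j 2^-1 * (`|w i| * `|w j|) * (x i ^+ 2 + x j ^+ 2) =
   2^-1 * (B * A + A * B).
  rewrite !mulr_suml -big_split mulr_sumr; apply: eq_bigr => i _ /=.
  rewrite !mulr_sumr -big_split mulr_sumr; apply: eq_bigr => j _ /=.
  by ring.
by rewrite -/A -/B; field.
Qed.

(** A quadratic bound keeps the Chernoff factor within the degree 4 of [mean_prod]. The coefficient
    must be below 1 for the mean to decay, and above 3 / 4 for the comparison exp y <= (1 - y /
    2)^-2 to yield it. *)
Lemma expR_le_quadratic y : `|y| <= 5^-1 -> expR y <= 1 + y + 7 / 8 * y ^+ 2.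
Proof.
rewrite ler_norml => /andP[y1 y2].
have h := expR_ge1Dx (- (y / 2)).
have p0 : 0 < 1 + - (y / 2) by lra.
have e : expR y = (expR (- (y / 2)))^-1 ^+ 2.
  by rewrite expRN invrK -expRM_natl mulrC divfK.
have : expR y <= (1 + - (y / 2))^-1 ^+ 2.
  by rewrite e lerXn2r ?nnegrE ?invr_ge0 ?expR_ge0 ?(ltW p0)// lef_pV2 ?posrE ?expR_gt0.
move/le_trans; apply; rewrite exprVn invf_ple ?posrE ?exprn_gt0//; last by nra.
rewrite -[_^-1]mul1r ler_pdivrMr; last by nra.
have y5 : 0 <= 1 - 5 * y by lra.
move: (mulr_ge0 (sqr_ge0 y) y5).
have := sqr_ge0 (y ^+ 2) => h1 h2; rewrite -subr_ge0.
have -> : (1 + - (y / 2)) ^+ 2 * (1 + y + 7 / 8 * y ^+ 2) - 1 =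
   8^-1 * (y ^+ 2 * (1 - 5 * y)) + 7 / 32 * (y ^+ 2) ^+ 2 by field.
lra.
Qed.

Lemma cos_multiples x : [/\ cos (2 * x) = 2 * cos x ^+ 2 - 1,
  cos (3 * x) = 4 * cos x ^+ 3 - 3 * cos x
  & cos (4 * x) = 8 * cos x ^+ 4 - 8 * cos x ^+ 2 + 1].
Proof.
have c2 y : cos (2 * y) = 2 * cos y ^+ 2 - 1.
  by rewrite mulr_natl cos_mulr2n mulr_natl.
split=> //.
  have -> : 3 * x = 2 * x + x by ring.
  rewrite cosD c2 [2 * x]mulr_natl sin_mulr2n.
  have -> : cos x * sin x *+ 2 * sin x = cos x * sin x ^+ 2 *+ 2.
    by rewrite -mulr_natl -[RHS]mulr_natl; ring.
  by rewrite sin2cos2; ring.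
have -> : 4 * x = 2 * (2 * x) by ring.
by rewrite c2 c2; ring.
Qed.

Lemma mean_riesz_sqr (M N : nat) s : (0 < M)%N ->
  continuous (fun t => \prod_(j < N) (1 + s * carrier M j t) ^+ 2) /\
  mean (fun t => \prod_(j < N) (1 + s * carrier M j t) ^+ 2) = (1 + s ^+ 2 / 2) ^+ N.
Proof.
move=> M0; pose A := nth 0 [:: 1 + s ^+ 2 / 2; 2 * s; s ^+ 2 / 2].
apply: (@mean_prod _ M N A (fun x => (1 + s * x) ^+ 2)) => // x.
have [c2 _ _] := cos_multiples x.
rewrite !big_ord_recl big_ord0 /A /= mul0r cos0 mul1r c2.
by field.
Qed.

(** The second order term - s^2 / 16 is (7 / 8 - 1) times s^2 / 2: the tilt towards small carriers
    loses mass, which is the source of the exponential gain. *)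
Lemma mean_riesz_chernoff (M N : nat) s : (0 < M)%N ->
  continuous (fun t => \prod_(j < N) ((1 + s * carrier M j t) ^+ 2 *
    (1 + - (s * carrier M j t) + 7 / 8 * (s * carrier M j t) ^+ 2))) /\
  mean (fun t => \prod_(j < N) ((1 + s * carrier M j t) ^+ 2 *
    (1 + - (s * carrier M j t) + 7 / 8 * (s * carrier M j t) ^+ 2))) =
  (1 - s ^+ 2 / 16 + 21 / 64 * s ^+ 4) ^+ N.
Proof.
move=> M0; pose A := nth 0 [:: 1 - s ^+ 2 / 16 + 21 / 64 * s ^+ 4;
  s + 9 / 16 * s ^+ 3; - (s ^+ 2 / 16) + 7 / 16 * s ^+ 4;
  3 / 16 * s ^+ 3; 7 / 64 * s ^+ 4].
apply: (@mean_prod _ M N A (fun x => (1 + s * x) ^+ 2 *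
  (1 + - (s * x) + 7 / 8 * (s * x) ^+ 2))) => // x.
have [c2 c3 c4] := cos_multiples x.
rewrite !big_ord_recl big_ord0 /A /= /bump/= mul0r cos0 mul1r.
rewrite c2 c3 c4.
by field.
Qed.

End RieszMixture.

(** * Coefficients, L^2 norm and lower tail of the signed mixture *)

Section MixtureEstimates.
Context {R : realType}.
Variables (a Om : R) (M N L : nat) (w s : nat -> R).
Hypotheses (M0 : (0 < M)%N) (a0 : 0 < a) (a8 : a <= 8^-1) (Om0 : 0 <= Om).
Hypothesis s_range : forall i, (i <= L)%N -> 2^-1 <= s i <= 1.
Hypothesis moment0 : \sum_(i < L.+1) w i = 1.
Hypothesis moment_vanish :
  forall m, (0 < m <= L)%N -> \sum_(i < L.+1) w i * s i ^+ m = 0.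
Hypothesis weights_le : \sum_(i < L.+1) `|w i| <= Om ^+ L.
Implicit Type t : R.

Let node (i : 'I_L.+1) := a * s i.

Let node_range i : a / 2 <= node i <= a.
Proof.
have /andP[s1 s2] := s_range (ltn_ord i : (i <= L)%N).
by rewrite /node ler_pM2l// s1 -[leRHS]mulr1 ler_pM2l.
Qed.

Definition mixture t : R :=
  \sum_(i < L.+1) w i * \prod_(j < N) (1 + a * s i * carrier M j t).

(** The value at 0 replaces the total mass 1, since the constant term is split off in
    [mixture_expansion]; the bound below then holds for every m. *)
Definition mixture_coef (m : nat) : R :=
  if m is 0%N then 0 else \sum_(i < L.+1) w i * (a * s i / 2) ^+ m.

(** Orders up to L vanish by the moment conditions; beyond L the power of the node is already at
    most a^L. *)
Lemma mixture_coef_le m : `|mixture_coef m| <= (a * Om) ^+ L.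
Proof.
have b0 : 0 <= (a * Om) ^+ L by rewrite exprn_ge0// mulr_ge0// ltW.
case: m => [|m]; rewrite /mixture_coef ?normr0//.
have a1 : a <= 1 by move: a8; lra.
have [mL|Lm] := leqP m.+1 L.
  under eq_bigr do rewrite mulrAC exprMn mulrCA.
  by rewrite -mulr_sumr moment_vanish// mulr0 normr0.
rewrite exprMn; apply: (@le_trans _ _ (a ^+ L * \sum_(i < L.+1) `|w i|)); last first.
  by apply: ler_wpM2l => //; rewrite exprn_ge0// ltW.
apply: (le_trans (ler_norm_sum _ _ _)); rewrite mulr_sumr; apply: ler_sum => i _.
rewrite normrM mulrC; apply: ler_wpM2r => //.
have /andP[h1 h2] := node_range i; have h0 : 0 <= node i / 2 by nra.
rewrite -/(node i) ger0_norm ?exprn_ge0//.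
apply: (@le_trans _ _ (a ^+ m.+1)); first by rewrite lerXn2r ?nnegrE ?(ltW a0)//; nra.
by apply: ler_wiXn2l => //; [exact: ltW | exact: ltnW].
Qed.

Lemma mixture_expansion t : mixture t = 1 +
  trig_sum (behead (riesz_terms M N)) (mixture_coef \o fst) snd t.
Proof.
have [T TE Tpos] := riesz_terms_head M N.
transitivity (\sum_(x <- riesz_terms M N)
    (\sum_(i < L.+1) w i * (a * s i / 2) ^+ x.1) * wave x.2 0 t).
  rewrite /mixture; under eq_bigr do rewrite riesz_expansion mulr_sumr.
  rewrite exchange_big; apply: eq_bigr => x _.
  by rewrite mulr_suml; apply: eq_bigr => i _; rewrite mulrA.
rewrite TE big_cons/=; congr (_ + _).
  under eq_bigr do rewrite expr0 mulr1.
  by rewrite moment0 mul1r /wave mul0r addr0 cos0.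
rewrite /trig_sum big_seq [RHS]big_seq; apply: eq_bigr => x /(allP Tpos).
by rewrite /mixture_coef/=; case: (x.1).
Qed.

Lemma mixture_sqr_le t : mixture t ^+ 2 <=
  Om ^+ L * \sum_(i < L.+1) `|w i| * \prod_(j < N) (1 + node i * carrier M j t) ^+ 2.
Proof.
apply: (le_trans (sqr_sum_le _ _)).
under [X in _ * X <= _]eq_bigr do rewrite -prodrXl.
apply: ler_wpM2r => //; apply: sumr_ge0 => i _; rewrite mulr_ge0//.
by apply: prodr_ge0 => j _; exact: sqr_ge0.
Qed.

Lemma continuous_mixture : continuous mixture.
Proof.
have -> : mixture = fun t => 1 +
    trig_sum (behead (riesz_terms M N)) (mixture_coef \o fst) snd t.
  by apply/funext => t; exact: mixture_expansion.
apply: continuous_addr; first by move=> t; exact: cvg_cst.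
exact: continuous_trig_sum.
Qed.

Let mean_average (P : 'I_L.+1 -> R -> R) (b : R) : 0 <= b ->
  (forall i, continuous (P i)) -> (forall i, mean (P i) <= b) ->
  continuous (fun t => Om ^+ L * \sum_(i < L.+1) `|w i| * P i t) /\
  mean (fun t => Om ^+ L * \sum_(i < L.+1) `|w i| * P i t) <= (Om ^+ 2) ^+ L * b.
Proof.
move=> b0 cP Pb; have cs : continuous (fun t => \sum_(i < L.+1) `|w i| * P i t).
  by apply: continuous_sumr => i; exact: continuous_scaler.
split; first exact: continuous_scaler.
rewrite meanZ// -exprM mulnC exprM expr2 -mulrA.
apply: ler_wpM2l; first exact: exprn_ge0.
rewrite mean_sum => [|i]; last exact: continuous_scaler.
apply: (@le_trans _ _ (\sum_(i < L.+1) `|w i| * b)).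
  by apply: ler_sum => i _; rewrite meanZ// ler_wpM2l.
by rewrite -mulr_suml ler_wpM2r.
Qed.

Lemma mean_mixture_sqr :
  mean (fun t => mixture t ^+ 2) <= (Om ^+ 2) ^+ L * expR (a ^+ 2 / 2) ^+ N.
Proof.
have PE i := mean_riesz_sqr N (node i) M0.
have b0 : 0 <= expR (a ^+ 2 / 2) ^+ N by rewrite exprn_ge0// expR_ge0.
have [||cV mV] := @mean_average
  (fun i t => \prod_(j < N) (1 + node i * carrier M j t) ^+ 2) _ b0.
- by move=> i; case: (PE i).
- move=> i; have [_ ->] := PE i; have /andP[h1 h2] := node_range i.
  rewrite lerXn2r ?nnegrE ?expR_ge0 ?addr_ge0// ?divr_ge0 ?sqr_ge0//.
  by apply: le_trans (expR_ge1Dx _); nra.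
apply: le_trans mV; apply: le_mean => // [|t]; last exact: mixture_sqr_le.
by under eq_fun do rewrite expr2; apply: continuous_mulr; exact: continuous_mixture.
Qed.

(** A Chernoff majorant at threshold a / 128 per carrier, with a polynomial in place of exp (- node
    * carrier) so that its mean is computed exactly. *)
Definition majorant t : R := Om ^+ L * \sum_(i < L.+1) `|w i| *
  (expR (a / 128 * node i) ^+ N *
   \prod_(j < N) ((1 + node i * carrier M j t) ^+ 2 *
    (1 + - (node i * carrier M j t) + 7 / 8 * (node i * carrier M j t) ^+ 2))).

Let quadratic_ge0 y : 0 <= 1 + - y + 7 / 8 * y ^+ 2 :> R.
Proof. by have := sqr_ge0 (y - 4 / 7); rewrite sqrrB; lra. Qed.

Lemma majorant_ge0 t : 0 <= majorant t.
Proof.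
rewrite mulr_ge0 ?exprn_ge0//; apply: sumr_ge0 => i _.
rewrite !mulr_ge0 ?exprn_ge0 ?expR_ge0//; apply: prodr_ge0 => j _.
by rewrite mulr_ge0 ?sqr_ge0.
Qed.

Lemma majorant_continuous_mean : continuous majorant /\
  mean majorant <= (Om ^+ 2) ^+ L * expR (- (a ^+ 2 / 256)) ^+ N.
Proof.
have PE i := mean_riesz_chernoff N (node i) M0.
apply: mean_average => [|i|i].
- by apply: exprn_ge0; exact: expR_ge0.
- by apply: continuous_scaler; case: (PE i).
- have [cP mP] := PE i; rewrite meanZ// mP -exprMn; have /andP[h1 h2] := node_range i.
  set x := node i in h1 h2 *.
  have a_gt0 := a0; have a_le := a8.
  have x0 : 0 <= x by lra.
  have x2 : x ^+ 2 <= 64^-1 by nra.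
  have x4 : x ^+ 4 <= 64^-1 * x ^+ 2.
    by rewrite (exprM x 2 2) expr2 ler_wpM2r ?sqr_ge0.
  have p : 0 <= 1 - x ^+ 2 / 16 + 21 / 64 * x ^+ 4.
    by have : 0 <= x ^+ 4; [rewrite (exprM x 2 2) sqr_ge0 | lra].
  rewrite lerXn2r ?nnegrE ?mulr_ge0 ?expR_ge0//.
  (* Half of x^2 / 16 absorbs the fourth order term. With x >= a / 2 the threshold costs at most x^2
     / 64, and the remaining - x^2 / 64 is at most - a^2 / 256. *)
  apply: (@le_trans _ _ (expR (a / 128 * x) * expR (- (x ^+ 2 / 32)))).
    rewrite ler_wpM2l ?expR_ge0//; apply: le_trans (expR_ge1Dx _).
    by have := sqr_ge0 x; lra.
  rewrite -expRD ler_expR.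
  have : a * x <= 2 * x ^+ 2 by nra.
  have : a ^+ 2 <= 4 * x ^+ 2 by nra.
  lra.
Qed.

(* Chernoff: on this set the added factor dominates exp (- node * sum carrier). *)
Lemma mixture_le_majorant t :
  \sum_(j < N) carrier M j t <= a / 128 * N%:R -> mixture t ^+ 2 <= majorant t.
Proof.
move=> sX; apply: (le_trans (mixture_sqr_le t)).
rewrite ler_wpM2l ?exprn_ge0//; apply: ler_sum => i _; rewrite ler_wpM2l//.
have a_gt0 := a0; have a_le := a8.
have /andP[h1 h2] := node_range i; set x := node i in h1 h2 *.
have x0 : 0 <= x by lra.
rewrite [in leRHS]big_split [leRHS]mulrCA; apply: ler_peMr.
  by apply: prodr_ge0 => j _; exact: sqr_ge0.
apply: (@le_trans _ _ (expR (a / 128 * x) ^+ N *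
    \prod_(j < N) expR (- (x * carrier M j t)))).
  rewrite -expR_sum -expRM_natl -expRD; apply: le_trans (expR_ge1Dx _).
  rewrite lerDl sumrN -mulr_sumr.
  have -> (S : R) : N%:R * (a / 128 * x) - x * S = x * (a / 128 * N%:R - S) by ring.
  by rewrite mulr_ge0 ?subr_ge0.
rewrite ler_wpM2l ?exprn_ge0 ?expR_ge0//; apply: ler_prod => j _.
rewrite expR_ge0/= -[X in 7 / 8 * X]sqrrN; apply: expR_le_quadratic.
rewrite normrN normrM; have := normr_wave (M * 5 ^ j)%N 0 t.
by rewrite -/(carrier M j t) (ger0_norm (_ : 0 <= x)); nra.
Qed.

End MixtureEstimates.

(** * Choice of the parameters of the mixture *)

Section MixtureExistence.
Context {R : realType}.

Lemma exists_half_pow (e : R) : 0 < e ->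
  exists2 L : nat, (0 < L)%N & 4 * 2^-1 ^+ L <= e.
Proof.
move=> e0; pose L := (Num.truncn (4 / e)).+1; exists L => //.
have eL : 4 / e < L%:R by rewrite /L; exact: truncnS_gt.
have LL : L%:R <= 2 ^+ L :> R by rewrite -natrX ler_nat ltnW// ltn_expl.
rewrite exprVn ler_pdivrMr ?exprn_gt0// mulrC -ler_pdivrMr//.
by rewrite (le_trans (ltW eL)).
Qed.

(** The order of the quantifiers is the point: only L and N depend on eps, while a, and with it c,
    depends on q alone. *)
Lemma riesz_mixture (q : R) : 2 < q -> exists c : R, 0 < c /\
  forall (M : nat) (eps : R), (0 < M)%N -> 0 < eps ->
  exists (N : nat) (T : seq (nat * int)) (gam : nat -> R) (sigma B : R) (V : R -> R),
  let G := trig_sum T (gam \o fst) snd in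
  [/\ (0 < N)%N /\ uniq (map snd T),
      0 <= sigma <= eps /\ (forall i, `|gam i| <= sigma),
      sigma `^ (q - 2) * B <= eps /\ mean (fun t => G t ^+ 2) <= B,
      [/\ continuous V, forall t, 0 <= V t & mean V <= eps]
    & forall t, \sum_(j < N) carrier M j t <= c *+ 2 * N%:R ->
        (1 + G t) ^+ 2 <= V t].
Proof.
move=> q2; pose Om : R := 8 * expR 1.
have Om1 : 1 <= Om.
  by rewrite /Om; have : 1 <= expR 1 :> R; [rewrite ltW// expR_gt1 | lra].
have Om0 : 0 < Om by lra.
(* With N a^2 = kap L, the tail gain exp (- kap / 256) must beat the weight factor Om^2 for each
   unit of L. *)
have [kap kap_gt0 kapE] : exists2 kap : nat, (0 < kap)%N & 512 * Om ^+ 2 <= kap%:R.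
  by exists (Num.truncn (512 * Om ^+ 2)).+1; rewrite // ltW// truncnS_gt.
have kap1 : expR (- (kap%:R / 256)) * Om ^+ 2 <= 2^-1.
  rewrite expRN mulrC ler_pdivrMr ?expR_gt0//.
  by have := expR_ge1Dx (kap%:R / 256 : R); lra.
(* The growth of the squared L^2 norm per unit of L. It does not involve a, so a can be chosen after
   it. *)
pose E : R := Om ^+ 2 * expR (kap%:R / 2).
have E1 : 1 <= E.
  rewrite /E -[1]mulr1 ler_pM//; first by rewrite expr2; nra.
  by apply: le_trans (expR_ge1Dx _); rewrite lerDl divr_ge0.
have E0 : 0 < E by lra.
(* Solves del^(q - 2) E = 1 / 2; with a Om <= del, the powers sigma^(q - 2) beat E^L. *)
pose del : R := (2 * E)^-1 `^ (q - 2)^-1.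
have del0 : 0 < del by rewrite powR_gt0// invr_gt0 mulr_gt0.
(* Taking a = 1 / r with r an integer makes N = kap r^2 L satisfy N a^2 = kap L exactly. *)
have [r r_gt0 rE] : exists2 r : nat, (0 < r)%N & 8 + 2 * Om + Om / del <= r%:R.
  by exists (Num.truncn (8 + 2 * Om + Om / del)).+1; rewrite // ltW// truncnS_gt.
have Od0 : 0 < Om / del by rewrite divr_gt0.
have r0 : 0 < r%:R :> R by rewrite ltr0n.
pose a : R := r%:R^-1; have a0 : 0 < a by rewrite invr_gt0.
have a8 : a <= 8^-1 by rewrite lef_pV2 ?posrE//; lra.
have aOm : a * Om <= 2^-1 by rewrite mulrC ler_pdivrMr//; lra.
have aOmdel : a * Om <= del.
  by rewrite mulrC ler_pdivrMr// mulrC -ler_pdivrMr//; lra.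
have aO0 : 0 <= a * Om by rewrite mulr_ge0 ?ltW.
have powE : (a * Om) `^ (q - 2) * E <= 2^-1.
  rewrite -ler_pdivlMr// -invfM.
  apply: (@le_trans _ _ (del `^ (q - 2))).
    by apply: ge0_ler_powR; rewrite ?nnegrE ?(ltW del0)// subr_ge0 ltW.
  by rewrite -powRrM mulVf ?powRr1 ?subr_eq0 ?gt_eqF// invr_ge0 mulr_ge0 ?ltW.
exists (a / 256); split; first by apply: divr_gt0; [exact: a0 | exact: ltr0Sn].
move=> M eps M0 eps0.
have [L L0 Leps] := exists_half_pow eps0.
have hL0 : 0 < 2^-1 ^+ L :> R by rewrite exprn_gt0.
have [w [s [s_range mom0 mom ws]]] := @vanishing_moments R L L0.
pose N := (kap * r ^ 2 * L)%N.
have aN : N%:R * a ^+ 2 = kap%:R * L%:R.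
  rewrite /N natrM natrM natrX /a.
  by field; rewrite gt_eqF.
exists N, (behead (riesz_terms M N)), (mixture_coef a L w s), ((a * Om) ^+ L).
(* The factor 4 comes from G^2 <= 2 (1 + G)^2 + 2 and E >= 1. *)
exists (4 * E ^+ L), (majorant a Om M N L w s) => /=.
set G := trig_sum _ _ _.
have FE t : 1 + G t = mixture a M N L w s t by rewrite (mixture_expansion _ _ _ _ mom0).
have sigma_le : (a * Om) ^+ L <= 2^-1 ^+ L by rewrite lerXn2r ?nnegrE ?invr_ge0.
split.
- split; first by rewrite !muln_gt0 kap_gt0 r_gt0.
  have [T TE _] := riesz_terms_head M N; have := riesz_terms_uniq N M0.
  by rewrite TE /= => /andP[].
- split; first by rewrite exprn_ge0//=; apply: (le_trans sigma_le); lra.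
  by move=> m; exact: (mixture_coef_le a0 a8 (ltW Om0) s_range mom ws).
- split.
    have -> : ((a * Om) ^+ L) `^ (q - 2) = ((a * Om) `^ (q - 2)) ^+ L.
      by rewrite -[LHS]/((_ ^+ L) `^ _) -powR_mulrn// powRAC powR_mulrn// powR_ge0.
    rewrite mulrCA -exprMn; apply: le_trans Leps; apply: ler_wpM2l => //.
    apply: lerXn2r; rewrite ?nnegrE//.
    by apply: mulr_ge0; [exact: powR_ge0 | exact: ltW].
  have cF := @continuous_mixture R a M N L w s mom0.
  have cF2 : continuous (fun t => mixture a M N L w s t ^+ 2).
    by under eq_fun do rewrite expr2; exact: continuous_mulr.
  have mF := mean_mixture_sqr N M0 a0 (ltW Om0) s_range mom0 ws.
  have FEL : (Om ^+ 2) ^+ L * expR (a ^+ 2 / 2) ^+ N = E ^+ L.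
    rewrite /E [in RHS]exprMn; congr (_ * _).
    by rewrite -!expRM_natl mulrA aN; congr expR; ring.
  apply: (@le_trans _ _ (mean (fun t => 2 * mixture a M N L w s t ^+ 2 + 2))).
    apply: le_mean.
    + under eq_fun do rewrite expr2.
      by apply: continuous_mulr; exact: continuous_trig_sum.
    + by apply: continuous_addr; [exact: continuous_scaler | move=> t; exact: cvg_cst].
    + by move=> t; rewrite -FE; have := sqr_ge0 (G t + 2); nra.
  rewrite meanD ?meanZ ?mean_cst//; last 2 first.
  + exact: continuous_scaler.
  + by move=> t; exact: cvg_cst.
  rewrite FEL in mF; have : 1 <= E ^+ L by exact: exprn_ege1.
  by move: mF; lra.
- have [cV mV] := majorant_continuous_mean N M0 a0 a8 (ltW Om0) s_range ws.
  split=> // [t|]; first by apply: majorant_ge0; exact: ltW.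
  apply: (le_trans mV); rewrite -expRM_natl mulrN mulrA aN.
  have -> : - (kap%:R * L%:R / 256) = L%:R * (- (kap%:R / 256)) :> R by ring.
  rewrite expRM_natl -exprMn; apply: (@le_trans _ _ (2^-1 ^+ L)); last by lra.
  by rewrite lerXn2r ?nnegrE ?invr_ge0 ?mulr_ge0 ?expR_ge0// mulrC.
- move=> t ht; rewrite FE.
  apply: (mixture_le_majorant a0 a8 (ltW Om0) s_range ws).
  apply: (le_trans ht); rewrite le_eqVlt; apply/orP; left; apply/eqP; congr (_ * _).
  by rewrite -mulr_natl; field.
Qed.

End MixtureExistence.

(** * A twice differentiable cutoff *)

Section SmoothTruncation.
Context {R : realType}.
Implicit Types (f g : R -> R) (b t x : R).

Definition isC2 f : Prop := exists b, C2 b f.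

Lemma isC2_continuous f : isC2 f -> continuous f.
Proof. by move=> [b /C2_continuous]. Qed.

Lemma isC2M f g : isC2 f -> isC2 g -> isC2 (fun t => f t * g t).
Proof. by move=> [a Cf] [b Cg]; exists (4 * a * b); exact: C2M. Qed.

Lemma isC2_cst b : isC2 (fun=> b).
Proof.
exists `|b|, (fun=> 0), (fun=> 0); split=> // [t|t|t|t].
- exact: is_derive_cst.
- exact: is_derive_cst.
- exact: cvg_cst.
- by rewrite normr0.
Qed.

Lemma isC2D f g : isC2 f -> isC2 g -> isC2 (fun t => f t + g t).
Proof.
move=> [a [f1 [f2 [df df1 cf2 [pf pf1] bf]]]] [b [g1 [g2 [dg dg1 cg2 [pg pg1] bg]]]].
exists (a + b), (fun t => f1 t + g1 t), (fun t => f2 t + g2 t); split.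
- by move=> t; exact: is_derive1D.
- by move=> t; exact: is_derive1D.
- exact: continuous_addr.
- by rewrite pf pf1 pg pg1.
- move=> t; have [? ? ?] := bf t; have [? ? ?] := bg t.
  by split; apply: (le_trans (ler_normD _ _)); exact: lerD.
Qed.

Lemma isC2Z (c : R) f : isC2 f -> isC2 (fun t => c * f t).
Proof. by move=> Cf; apply: isC2M => //; exact: isC2_cst. Qed.

Lemma isC2_sum (I : Type) (r : seq I) (F : I -> R -> R) : (forall i, isC2 (F i)) ->
  isC2 (fun t => \sum_(i <- r) F i t).
Proof.
move=> CF; elim: r => [|i r ih].
  by under eq_fun do rewrite big_nil; exact: isC2_cst.
by under eq_fun do rewrite big_cons; exact: isC2D.
Qed.

Lemma isC2_wave n (a : R) : isC2 (wave n a).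
Proof.
pose N : R := n%:~R.
exists (1 + `|N| + `|N| ^+ 2), (fun t => N * wave n (a + pi / 2) t),
  (fun t => N * (N * wave n (a + pi / 2 + pi / 2) t)).
have N0 : 0 <= `|N| by [].
split.
- exact: is_derive_wave.
- by move=> t; apply: is_derive1Z; exact: is_derive_wave.
- by do 2 apply: continuous_scaler; exact: continuous_wave.
- by rewrite !wave_period.
- move=> t; rewrite !normrM.
  have w d : `|wave n d t| <= 1 by exact: normr_wave.
  have w0 d : 0 <= `|wave n d t| by [].
  split; [have := w a|have := w (a + pi / 2)|have := w (a + pi / 2 + pi / 2)].
  + by have := sqr_ge0 `|N|; lra.
  + by have := w0 (a + pi / 2); have := sqr_ge0 `|N|; nra.
  + rewrite mulrA -expr2 => h; have := ler_wpM2l (sqr_ge0 `|N|) h; lra.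
Qed.

Lemma is_derive_mul_norm x : is_derive x 1 (fun y : R => y * `|y|) (2 * `|x|).
Proof.
have dsq (y : R) : is_derive y (1 : R) (fun z : R => z * z) (2 * y).
  apply: (is_derive_eq (is_derive1M (is_derive_id y 1) (is_derive_id y 1))).
  by rewrite mul1r mulr1 mulr_natl.
have [x0|x0|->] := ltgtP x 0.
- rewrite ltr0_norm// mulrN -mulN1r mulrCA.
  apply: (@near_eq_is_derive _ _ _ (fun z : R => -1 * (z * z))).
  + near=> y; rewrite ltr0_norm ?mulN1r ?mulrN//; near: y; exact: lt_nbhsl.
  + by rewrite mulrCA; exact: is_derive1Z.
- rewrite gtr0_norm//.
  apply: (@near_eq_is_derive _ _ _ (fun z : R => z * z)) => //.
  near=> y; rewrite gtr0_norm//; near: y; exact: lt_nbhsr.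
rewrite normr0 mulr0.
have h0 : (fun h : R => h^-1 *: ((h *: (1 : R) + 0) * `|h *: (1 : R) + 0| - 0 * `|0 : R|))
    @ (0 : R)^' --> (0 : R).
  apply: (@cvg_trans _ ((fun h : R => `|h|) @ 0^')).
    apply: near_eq_cvg; near=> h.
    have h0 : h != 0 by near: h; exact: nbhs_dnbhs_neq.
    by rewrite normr0 mulr0 subr0 addr0 -[h *: 1]/(h * 1) mulr1 -[RHS]/(_ * _) mulKf.
  have : (fun h : R => `|h|) @ 0^' --> `|0 : R|.
    by apply: cvg_norm; exact: cvg_within.
  by rewrite normr0.
apply: DeriveDef; first by apply/cvg_ex; exists 0.
exact: cvg_lim h0.
Unshelve. all: by end_near. Qed.

(** The cube of the positive part, written through x |x| so that its two derivatives come from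
    [is_derive_mul_norm]. *)
Definition cube_pos x : R := 2^-1 * (x * (x * x + x * `|x|)).

Lemma cube_pos_le0 x : x <= 0 -> cube_pos x = 0.
Proof. by move=> x0; rewrite /cube_pos ler0_norm// mulrN subrr !mulr0. Qed.

Lemma cube_pos_ge0E x : 0 <= x -> cube_pos x = x ^+ 3.
Proof. by move=> x0; rewrite /cube_pos ger0_norm//; field. Qed.

Lemma isC2_cube_pos f : isC2 f -> isC2 (fun t => cube_pos (f t)).
Proof.
move=> [b Cf]; have b0 := C2_ge0 Cf; have cf := C2_continuous Cf.
move: Cf => [f1 [f2 [df df1 cf2 [pf pf1] bf]]]; have cf1 := is_derive1_continuous df1.
pose p1 x : R := 3 / 2 * (x * x + x * `|x|).
pose p2 x : R := 3 * (x + `|x|).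
have did (y : R) : is_derive y (1 : R) (fun z : R => z) 1 by exact: is_derive_id.
have dq (y : R) : is_derive y (1 : R) (fun z : R => z * z + z * `|z|) (2 * (y + `|y|)).
  apply: (is_derive_eq (is_derive1D (is_derive1M (did y) (did y)) (is_derive_mul_norm y))).
  by ring.
have d0 (y : R) : is_derive y (1 : R) cube_pos (p1 y).
  apply: (is_derive_eq (is_derive1Z 2^-1 (is_derive1M (did y) (dq y)))).
  by rewrite /p1; field.
have d1 (y : R) : is_derive y (1 : R) p1 (p2 y).
  apply: (is_derive_eq (is_derive1Z (3 / 2) (dq y))).
  by rewrite /p2; field.
have c1 : continuous p1 by exact: is_derive1_continuous d1.
have c2 : continuous p2.
  apply: continuous_scaler; apply: continuous_addr => x; first exact: cvg_id.
  exact: norm_continuous.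
have comp (g : R -> R) : continuous g -> continuous (fun t => g (f t)).
  by move=> cg t; apply: (@continuous_comp _ _ _ f g); [exact: cf | exact: cg].
exists (b ^+ 3 + 3 * b ^+ 3 + (6 * b ^+ 3 + 3 * b ^+ 3)).
exists (fun t => p1 (f t) * f1 t).
exists (fun t => (p2 (f t) * f1 t) * f1 t + p1 (f t) * f2 t); split.
- by move=> t; exact: (is_derive1_comp (d0 _) (df t)).
- by move=> t; exact: (is_derive1M (is_derive1_comp (d1 _) (df t)) (df1 t)).
- apply: continuous_addr; apply: continuous_mulr => //; last exact: comp.
  by apply: continuous_mulr => //; exact: comp.
- by rewrite pf pf1.
- move=> t; have [y0 y1 y2] := bf t.
  have n2 : `|f t| ^+ 2 <= b ^+ 2 by rewrite lerXn2r ?nnegrE.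
  have p1b : `|p1 (f t)| <= 3 * b ^+ 2.
    rewrite normrM ger0_norm ?divr_ge0//.
    have h : `|f t * f t + f t * `|f t| | <= `|f t| ^+ 2 + `|f t| ^+ 2.
      by apply: (le_trans (ler_normD _ _)); rewrite !normrM normr_id -expr2.
    by have := ler_wpM2l (_ : 0 <= 3 / 2 :> R) h; rewrite divr_ge0// => /(_ isT); lra.
  have p2b : `|p2 (f t)| <= 6 * b.
    rewrite normrM ger0_norm//.
    have h := ler_normD (f t) `|f t|; rewrite normr_id in h; lra.
  have p0b : `|cube_pos (f t)| <= b ^+ 3.
    rewrite normrM ger0_norm ?invr_ge0// normrM.
    have h : `|f t * f t + f t * `|f t| | <= 2 * b ^+ 2.
      by apply: (le_trans (ler_normD _ _)); rewrite !normrM normr_id -expr2; lra.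
    have := ler_pM (normr_ge0 _) (normr_ge0 _) y0 h.
    by rewrite exprS; lra.
  have b3 : 0 <= b ^+ 3 by rewrite exprn_ge0.
  have q1 : `|p1 (f t) * f1 t| <= 3 * b ^+ 3.
    by rewrite normrM exprSr mulrA; exact: ler_pM.
  have q2 : `|p1 (f t) * f2 t| <= 3 * b ^+ 3.
    by rewrite normrM exprSr mulrA; exact: ler_pM.
  have q3 : `|p2 (f t) * f1 t * f1 t| <= 6 * b ^+ 3.
    have h := ler_pM (normr_ge0 _) (normr_ge0 _) p2b y1.
    rewrite -normrM in h; have := ler_pM (normr_ge0 _) (normr_ge0 _) h y1.
    by rewrite -normrM !exprS expr0; lra.
  split; [lra | lra |].
  by apply: (le_trans (ler_normD _ _)); lra.
Qed.

(** Two nested positive cubes make it constant on both sides of [0, 1] while staying C^2. *)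
Definition smooth_step x : R := 1 - cube_pos (1 - cube_pos x).

Lemma isC2_smooth_step f : isC2 f -> isC2 (fun t => smooth_step (f t)).
Proof.
have isC2B g : isC2 g -> isC2 (fun t => 1 - g t).
  move=> Cg; have -> : (fun t => 1 - g t) = (fun t => 1 + -1 * g t).
    by apply/funext => t; rewrite mulN1r.
  by apply: isC2D; [exact: isC2_cst | exact: isC2Z].
by move=> Cf; apply: (isC2B _); apply: isC2_cube_pos; apply: (isC2B _); exact: isC2_cube_pos.
Qed.

Lemma smooth_step_le0 x : x <= 0 -> smooth_step x = 0.
Proof.
move=> x0; rewrite /smooth_step (cube_pos_le0 x0) subr0 cube_pos_ge0E//.
by rewrite expr1n subrr.
Qed.

Lemma smooth_step_ge1 x : 1 <= x -> smooth_step x = 1.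
Proof.
move=> x1; rewrite /smooth_step (@cube_pos_le0 (1 - _)) ?subr0// subr_le0.
by rewrite cube_pos_ge0E ?exprn_ege1// (le_trans _ x1).
Qed.

Lemma smooth_step_range x : 0 <= smooth_step x <= 1.
Proof.
have [x0|/ltW x0] := leP x 0; first by rewrite smooth_step_le0// lexx ler01.
have [x1|/ltW x1] := leP 1 x; first by rewrite smooth_step_ge1// lexx ler01.
have h : 0 <= x ^+ 3 <= 1 by rewrite exprn_ge0// exprn_ile1.
case/andP: h => h1 h2.
rewrite /smooth_step (cube_pos_ge0E x0) cube_pos_ge0E ?subr_ge0//.
by rewrite gerBl exprn_ile1 ?exprn_ge0 ?subr_ge0 ?gerBl.
Qed.

End SmoothTruncation.

(** * Multiplication by one truncated mixture *)

Section ConstructionStep.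
Context {R : realType}.
Implicit Types (f g : R -> R) (b t x y : R).

Lemma powR_normD_le x y (q : R) : 0 <= q ->
  `|x + y| `^ q <= 2 `^ q * (`|x| `^ q + `|y| `^ q).
Proof.
move=> q0; wlog xy : x y / `|y| <= `|x|.
  move=> h; have [/h //|/ltW /h] := leP `|y| `|x|.
  by rewrite addrC (addrC (`|y| `^ q)).
apply: (@le_trans _ _ ((2 * `|x|) `^ q)).
  apply: ge0_ler_powR; rewrite ?nnegrE ?mulr_ge0//.
  by apply: (le_trans (ler_normD _ _)); lra.
rewrite powRM// ler_wpM2l ?powR_ge0// lerDl; exact: powR_ge0.
Qed.

(** Interpolation of l_q between l_2 and the sup norm: a large l_2 norm is harmless when every
    coefficient is tiny. *)
Lemma powR_norm_le_sqr x (q sigma : R) : 2 < q -> `|x| <= sigma ->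
  `|x| `^ q <= sigma `^ (q - 2) * x ^+ 2.
Proof.
move=> q2 xs; have s0 : 0 <= sigma by apply: le_trans xs.
have -> : `|x| `^ q = `|x| `^ (q - 2) * x ^+ 2.
  have q0 : q != 0 by rewrite gt_eqF//; lra.
  have := @powRD _ `|x| (q - 2) 2; rewrite subrK (negbTE q0) => -> //.
  by rewrite -[2 in X in _ * X]/(2%:R) powR_mulrn// real_normK// num_real.
rewrite ler_wpM2r ?sqr_ge0//; apply: ge0_ler_powR; rewrite ?nnegrE//; lra.
Qed.

(** The new function is f (1 + G) chi, so the change is f G - f e with e = (1 + G)(1 - chi). The
    first part has uniformly small coefficients, the second a small L^2 norm. *)
Lemma construction_step (q : R) : 2 < q -> exists c : R, 0 < c /\
  forall (f : R -> R) (M : nat) (eps : R), isC2 f -> (0 < M)%N -> 0 < eps ->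
  exists (N : nat) (f' : R -> R), [/\ (0 < N)%N /\ isC2 f',
    forall t, \sum_(j < N) carrier M j t <= c * N%:R -> f' t = 0,
    forall t, f t = 0 -> f' t = 0,
    forall (phi : R -> R) b, C2 b phi ->
      `|mean (fun t => (f' t - f t) * phi t)| <= eps * b
  & forall (a : R) (s : seq int), uniq s ->
      \sum_(n <- s) `|mean (fun t => (f' t - f t) * wave n a t)| `^ q <= eps].
Proof.
move=> q2; have [c [c0 mix]] := riesz_mixture q2; exists c; split=> //.
move=> f M eps [A CA] M0 eps0.
have A0 := C2_ge0 CA; have cf := C2_continuous CA.
pose C : R := 2 `^ q * ((5 * A) `^ (q - 2) * A ^+ 2 + A ^+ 2).
have C0 : 0 <= C by rewrite mulr_ge0 ?addr_ge0 ?mulr_ge0 ?powR_ge0 ?sqr_ge0.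
(* Collects what eta = 1 / D must beat. Of 21 A, the share 20 A is the 5 of [trig_sum_coef] times
   the 4 of [C2M], and A is the truncation error. *)
pose D : R := 1 + (21 * A / eps + A ^+ 2 + C / eps).
have e1 : 0 <= 21 * A / eps by rewrite divr_ge0 ?mulr_ge0// ltW.
have e2 : 0 <= C / eps by rewrite divr_ge0// ltW.
have e3 := sqr_ge0 A.
have D1 : 1 <= D by rewrite /D; lra.
have D0 : 0 < D by lra.
pose eta := D^-1; have eta0 : 0 < eta by rewrite invr_gt0.
have eta1 : eta <= 1 by rewrite invf_le1.
have etaA : 21 * A * eta <= eps.
  by rewrite ler_pdivrMr// -ler_pdivrMl// mulrC; rewrite /D; lra.
have etaA2 : A ^+ 2 * eta <= 1 by rewrite ler_pdivrMr// mul1r /D; lra.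
have etaC : C * eta <= eps.
  by rewrite ler_pdivrMr// -ler_pdivrMl// mulrC; rewrite /D; lra.
have eta2 : eta ^+ 2 <= eta by rewrite expr2 ger_pMr.
have eta20 : 0 < eta ^+ 2 by rewrite exprn_gt0.
(* Precision eta^2 for the mean of V gives precision eta in L^2. *)
have := mix M _ M0 eta20.
move=> [N [T [gam [sigma [B [V /= [[N0 uT] [/andP[s0 s1] gs] [sB mG] [cV V0 mV] GV]]]]]]].
set G := trig_sum T (gam \o fst) snd in mG GV *.
have NR : 0 < N%:R :> R by rewrite ltr0n.
have gs' (i : nat * int) : `|(gam \o fst) i| <= sigma by exact: gs.
pose X t := \sum_(j < N) carrier M j t.
(* Vanishes for X <= c N and equals 1 for X >= 2 c N; wherever it truncates, (1 + G)^2 is therefore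
   below V. *)
pose chi t := smooth_step ((c * N%:R)^-1 * X t - 1).
have cG : continuous G by exact: continuous_trig_sum.
have C2G : isC2 G by apply: isC2_sum => i; apply: isC2Z; exact: isC2_wave.
have C2chi : isC2 chi.
  apply: isC2_smooth_step; apply: isC2D; last exact: isC2_cst.
  by apply: isC2Z; apply: isC2_sum => j; exact: isC2_wave.
have C2F : isC2 (fun t => 1 + G t) by apply: isC2D => //; exact: isC2_cst.
have chi01 t : 0 <= chi t <= 1 by exact: smooth_step_range.
have cN0 : 0 < c * N%:R by rewrite mulr_gt0.
pose e t := (1 + G t) * (1 - chi t).
have ce : continuous e.
  apply: continuous_mulr; first exact: isC2_continuous.
  by move=> t; apply: cvgB; [exact: cvg_cst | exact: isC2_continuous C2chi _].
have eV t : e t ^+ 2 <= V t.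
  have [Xt|Xt] := leP (X t) (c *+ 2 * N%:R).
    apply: le_trans (GV t Xt); rewrite /e exprMn ler_piMr ?sqr_ge0//.
    by case/andP: (chi01 t) => h1 h2; rewrite exprn_ile1 ?subr_ge0// gerBl.
  rewrite /e /chi smooth_step_ge1 ?subrr ?mulr0 ?expr0n//.
  rewrite lerBrDr -ler_pdivrMl ?invr_gt0// invrK mulrC.
  by rewrite mulrDl mul1r -mulr2n -mulrnAl ltW.
have fE t : f t * ((1 + G t) * chi t) - f t = f t * G t - f t * e t.
  by rewrite /e; ring.
exists N, (fun t => f t * ((1 + G t) * chi t)); split.
- by split=> //; apply: isC2M; [exists A | exact: isC2M].
- move=> t Xt; rewrite /chi smooth_step_le0 ?mulr0// subr_le0.
  by rewrite ler_pdivrMl// mulr1.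
- by move=> t ->; rewrite mul0r.
- move=> phi b Cphi; have b0 := C2_ge0 Cphi; have cphi := C2_continuous Cphi.
  have cfp : continuous (fun t => f t * phi t) by exact: continuous_mulr.
  rewrite (@eq_mean _ _ (fun t => f t * phi t * G t * wave 0 0 t - f t * phi t * e t)) =>
    [|t]; last by rewrite fE /wave mul0r addr0 cos0; ring.
  have c1 : continuous (fun t => f t * phi t * G t * wave 0 0 t).
    by apply: continuous_mulr; [exact: continuous_mulr | exact: continuous_wave].
  have c2 : continuous (fun t => f t * phi t * e t) by exact: continuous_mulr.
  rewrite meanB//; apply: (le_trans (ler_normB _ _)).
  have h1 := trig_sum_coef 0 0 uT s0 gs' (C2M CA Cphi).
  have h2 : `|mean (fun t => f t * phi t * e t)| <= A * b * eta.
    (* The pointwise inequality |e| <= (eta + e^2 / eta) / 2 turns the bound on the mean of e^2 into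
       one on the mean of |e|. *)
    pose W t := A * b / 2 * (eta + eta^-1 * V t).
    have cW : continuous W.
      apply: continuous_scaler; apply: continuous_addr; first by move=> t; exact: cvg_cst.
      exact: continuous_scaler.
    apply: (@le_trans _ _ (mean W)).
      apply: normr_mean => // t; rewrite normrM /W -mulrA; apply: ler_pM => //.
        by rewrite normrM ler_pM// (C2_bounded _ CA, C2_bounded _ Cphi).
      have -> : 2^-1 * (eta + eta^-1 * V t) = (eta ^+ 2 + V t) / (2 * eta).
        by field; rewrite gt_eqF.
      rewrite ler_pdivlMr ?mulr_gt0//; apply: le_trans (lerD (lexx _) (eV t)).
      rewrite -(real_normK (num_real (e t))).
      by have := sqr_ge0 (eta - `|e t|); rewrite sqrrB -mulr_natr; lra.
    rewrite /W meanZ; last first.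
      apply: continuous_addr; first by move=> t; exact: cvg_cst.
      exact: continuous_scaler.
    rewrite meanD ?mean_cst ?meanZ//; last 2 first.
    + by move=> t; exact: cvg_cst.
    + exact: continuous_scaler.
    have hV : eta^-1 * mean V <= eta by rewrite mulrC ler_pdivrMr// -expr2.
    have AB : 0 <= A * b / 2 by rewrite divr_ge0 ?mulr_ge0.
    have := ler_wpM2l AB (_ : eta + eta^-1 * mean V <= eta + eta); rewrite lerD2l => /(_ hV).
    by move/le_trans; apply; rewrite le_eqVlt; apply/orP; left; apply/eqP; field.
  apply: (le_trans (lerD h1 h2)).
  have Ab : 0 <= A * b by exact: mulr_ge0.
  have h3 : sigma * (A * b) <= eta * (A * b) by rewrite ler_wpM2r//; lra.
  have := ler_wpM2r b0 etaA; lra.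
- move=> a s us.
  pose x n := mean (fun t => f t * G t * wave n a t).
  pose y n := - mean (fun t => f t * e t * wave n a t).
  have cw n := @continuous_wave R n a.
  have cfG : continuous (fun t => f t * G t) by exact: continuous_mulr.
  have cfe : continuous (fun t => f t * e t) by exact: continuous_mulr.
  have xyE n : mean (fun t => (f t * ((1 + G t) * chi t) - f t) * wave n a t) = x n + y n.
    rewrite /x /y -meanB; [|exact: continuous_mulr..].
    by apply: eq_mean => t; rewrite fE mulrBl.
  have fb t : f t ^+ 2 <= A ^+ 2.
    rewrite -(real_normK (num_real (f t))).
    by rewrite lerXn2r ?nnegrE//; exact: (C2_bounded _ CA).
  have sqM g h : (forall t, g t ^+ 2 <= h t) -> continuous g -> continuous h ->
      mean (fun t => (f t * g t) ^+ 2) <= A ^+ 2 * mean h.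
    move=> gh cg ch; rewrite -meanZ//; apply: le_mean.
    + by under eq_fun do rewrite expr2; do 2 apply: continuous_mulr => //.
    + exact: continuous_scaler.
    + by move=> t; rewrite exprMn ler_pM ?sqr_ge0.
  have cG2 : continuous (fun t => G t ^+ 2).
    by under eq_fun do rewrite expr2; exact: continuous_mulr.
  have Sx : \sum_(n <- s) x n ^+ 2 <= A ^+ 2 * B.
    apply: (le_trans (Bessel a cfG us)).
    apply: (le_trans (sqM _ _ (fun t => lexx _) cG cG2)).
    by rewrite ler_wpM2l.
  have Sy : \sum_(n <- s) y n ^+ 2 <= A ^+ 2 * eta ^+ 2.
    under eq_bigr do rewrite sqrrN.
    apply: (le_trans (Bessel a cfe us)).
    by apply: (le_trans (sqM _ _ eV ce cV)); rewrite ler_wpM2l.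
  have y1 n : n \in s -> `|y n| <= 1.
    move=> ns; rewrite -(@expr_le1 _ 2)// real_normK ?num_real//.
    apply: (@le_trans _ _ (A ^+ 2 * eta ^+ 2)).
      apply: le_trans Sy; rewrite (bigD1_seq n)//= lerDl.
      by apply: sumr_ge0 => i _; exact: sqr_ge0.
    by apply: le_trans etaA2; rewrite ler_wpM2l.
  have x1 n : `|x n| <= sigma * (5 * A).
    exact: (trig_sum_coef n a uT s0 gs' CA).
  apply: (@le_trans _ _ (\sum_(n <- s) 2 `^ q *
      ((sigma * (5 * A)) `^ (q - 2) * x n ^+ 2 + y n ^+ 2))).
    rewrite big_seq [leRHS]big_seq; apply: ler_sum => n ns; rewrite xyE.
    apply: (le_trans (powR_normD_le _ _ _)); first lra.
    rewrite ler_wpM2l ?powR_ge0// lerD//; first exact: powR_norm_le_sqr.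
    by have := powR_norm_le_sqr q2 (y1 n ns); rewrite powR1 mul1r.
  rewrite -mulr_sumr big_split -mulr_sumr/=.
  apply: (@le_trans _ _ (C * eta)) => //.
  have -> : C * eta = 2 `^ q * ((5 * A) `^ (q - 2) * A ^+ 2 * eta + A ^+ 2 * eta).
    by rewrite /C; ring.
  apply: ler_wpM2l; first exact: powR_ge0.
  apply: lerD.
    rewrite powRM ?mulr_ge0//.
    apply: (@le_trans _ _ (sigma `^ (q - 2) * (5 * A) `^ (q - 2) * (A ^+ 2 * B))).
      by rewrite ler_wpM2l// mulr_ge0 ?powR_ge0.
    have h : 0 <= (5 * A) `^ (q - 2) * A ^+ 2 by rewrite mulr_ge0 ?powR_ge0.
    have := ler_wpM2l h (le_trans sB eta2); lra.
  by apply: (le_trans Sy); rewrite ler_wpM2l.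
Qed.

End ConstructionStep.

(** * Iteration of the step with summable errors *)

Section ConstructionSequence.
Context {R : realType}.
Implicit Types (f g : R -> R) (b t x y : R).

(** Peeling off one term at a time yields weights depending on k and not on K, which geometrically
    small errors absorb. *)
Lemma powR_norm_sum_le (q : R) (K : nat) (d : nat -> R) : 0 < q ->
  `|\sum_(k < K) d k| `^ q <= \sum_(k < K) (2 `^ q) ^+ k.+1 * `|d k| `^ q.
Proof.
move=> q0; elim: K d => [|K ih] d.
  by rewrite !big_ord0 normr0 powR0// gt_eqF.
rewrite !big_ord_recl expr1 /bump/=.
apply: (le_trans (powR_normD_le _ _ (ltW q0))); rewrite mulrDr lerD2l.
apply: (le_trans (ler_wpM2l (powR_ge0 _ _) (ih (fun k => d k.+1)))).
by rewrite mulr_sumr; apply: ler_sum => k _; rewrite [in leRHS]exprS mulrA.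
Qed.

Lemma sum_half_pow (b : R) (K : nat) : 0 <= b ->
  \sum_(k < K) b * 2^-1 ^+ k.+1 <= b.
Proof.
move=> b0; rewrite -mulr_sumr ler_piMr//.
suff -> : \sum_(k < K) 2^-1 ^+ k.+1 = 1 - 2^-1 ^+ K :> R.
  by rewrite gerBl exprn_ge0.
elim: K => [|K ih]; first by rewrite big_ord0 expr0 subrr.
by rewrite big_ord_recr/= ih exprS; field.
Qed.

Lemma cvg_half_increments (u : nat -> R) (b : R) :
  (forall k, `|u k.+1 - u k| <= b * 2^-1 ^+ k.+1) ->
  cvgn u /\ `|limn u - u 0%N| <= b.
Proof.
move=> ub; have b0 : 0 <= b.
  by have := le_trans (normr_ge0 _) (ub 0%N); rewrite pmulr_lge0// exprn_gt0.
have tel n : `|u n - u 0%N| <= \sum_(k < n) b * 2^-1 ^+ k.+1.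
  elim: n => [|n ih]; first by rewrite big_ord0 subrr normr0.
  rewrite big_ord_recr/= -(subrK (u n) (u n.+1)) -addrA addrC.
  by apply: (le_trans (ler_normD _ _)); exact: lerD.
have cu : cvgn u.
  have : cvgn (series (fun k => u k.+1 - u k)).
    apply: normed_cvg; apply: (@series_le_cvg _ _ (geometric (b / 2) 2^-1)).
    + by move=> n; exact: normr_ge0.
    + by move=> n; rewrite /geometric/= mulr_ge0 ?divr_ge0 ?exprn_ge0.
    + by move=> n; rewrite /geometric/= -mulrA -exprS; exact: ub.
    + apply: is_cvg_geometric_series; rewrite ger0_norm//; lra.
  have -> : series (fun k => u k.+1 - u k) = (fun n => u n - u 0%N).
    by apply/funext => n; rewrite /series/= telescope_sumr.
  move=> h; have -> : u = (fun n => (u n - u 0%N) + u 0%N).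
    by apply/funext => n; rewrite subrK.
  by apply: is_cvgD => //; exact: is_cvg_cst.
split=> //.
have : `|u n - u 0%N| @[n --> \oo] --> `|limn u - u 0%N|.
  by apply: cvg_norm; apply: cvgB => //; exact: cvg_cst.
move=> h; rewrite -(cvg_lim _ h)//; apply: limr_le.
  by apply/cvg_ex; eexists; exact: h.
by near=> n; exact: le_trans (tel n) (sum_half_pow _ b0).
Unshelve. all: by end_near. Qed.

(** The factor 1 / 2 in the increments keeps the limit functional within 1 / 2 of the mean at the
    constant 1, hence nonzero. *)
Lemma construction_sequence (q : R) : 2 < q ->
  exists (c C : R) (N : nat -> nat) (f : nat -> R -> R), [/\ 0 < c,
    (forall k, 0 < N k)%N /\ (forall k, isC2 (f k)),
    forall k m t, (k < m)%N ->
      \sum_(j < N k) carrier k.+1 j t <= c * (N k)%:R -> f m t = 0,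
    (forall t, f 0%N t = 1) /\
    (forall k (phi : R -> R) b, C2 b phi ->
      `|mean (fun t => f k.+1 t * phi t) - mean (fun t => f k t * phi t)|
        <= 2^-1 * b * 2^-1 ^+ k.+1)
  & forall (a : R) (s : seq int) K, uniq s ->
      \sum_(n <- s) `|mean (fun t => f K t * wave n a t)| `^ q <= C].
Proof.
move=> q2; have [c [c0 step]] := construction_step q2.
have Q0 : 0 < 2 `^ q :> R by rewrite powR_gt0.
have Q1 : 1 <= 2 `^ q :> R by rewrite -[leLHS](powRr0 2); apply: ler_powR; lra.
(* Cancels the weight (2^q)^(k + 1) of [powR_norm_sum_le] and leaves 4^-(k + 1). *)
pose eps (k : nat) : R := (4 * 2 `^ q)^-1 ^+ k.+1.
have eps0 k : 0 < eps k by rewrite exprn_gt0// invr_gt0 mulr_gt0.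
have /choice[nxt nxtP] (x : {f : R -> R | isC2 f} * nat) :
    exists y : nat * {f : R -> R | isC2 f}, [/\ (0 < y.1)%N,
      forall t, \sum_(j < y.1) carrier x.2.+1 j t <= c * y.1%:R -> sval y.2 t = 0,
      forall t, sval x.1 t = 0 -> sval y.2 t = 0,
      forall (phi : R -> R) b, C2 b phi ->
        `|mean (fun t => (sval y.2 t - sval x.1 t) * phi t)| <= eps x.2 * b
    & forall (a : R) (s : seq int), uniq s ->
      \sum_(n <- s) `|mean (fun t => (sval y.2 t - sval x.1 t) * wave n a t)| `^ q
        <= eps x.2].
  have [N [f' [[N0 Cf'] h1 h2 h3 h4]]] :=
    step (sval x.1) x.2.+1 (eps x.2) (svalP x.1) isT (eps0 x.2).
  by exists (N, exist _ f' Cf').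
pose F := fix F k : {f : R -> R | isC2 f} :=
  if k is k'.+1 then (nxt (F k', k')).2 else exist _ (fun=> 1) (isC2_cst 1).
pose N k := (nxt (F k, k)).1.
pose f k := sval (F k).
have FS k : f k.+1 = sval (nxt (F k, k)).2 by [].
have Cf k : isC2 (f k) by exact: (svalP (F k)).
have f_vanish k m t : (k < m)%N -> \sum_(j < N k) carrier k.+1 j t <= c * (N k)%:R ->
    f m t = 0.
  move=> km h; elim: m km => // m ih; rewrite ltnS leq_eqVlt => /predU1P[<-|/ih fm].
    by rewrite FS; have [_ h1 _ _ _] := nxtP (F k, k); exact: h1.
  by rewrite FS; have [_ _ h2 _ _] := nxtP (F m, m); exact: h2.
have epsE (k : nat) : (2 `^ q) ^+ k.+1 * eps k = 4^-1 ^+ k.+1.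
  rewrite /eps -exprMn; congr (_ ^+ _); rewrite invfM mulrCA mulfV ?mulr1//.
have eps_le (k : nat) : eps k <= 4^-1 ^+ k.+1.
  rewrite -epsE ler_peMl ?(ltW (eps0 k))//.
  by rewrite exprn_ege1.
have quarter (k : nat) : 4^-1 ^+ k.+1 <= 2^-1 * 2^-1 ^+ k.+1 :> R.
  have -> : 4^-1 = 2^-1 * 2^-1 :> R by rewrite -invfM -natrM.
  rewrite exprMn ler_wpM2r ?exprn_ge0//.
  by rewrite exprS ler_piMr// exprn_ile1//; lra.
have fw k n a : continuous (fun t => f k t * wave n a t).
  by apply: continuous_mulr; [exact: isC2_continuous | exact: continuous_wave].
have meanB_mul k (phi : R -> R) : continuous phi ->
    mean (fun t => f k.+1 t * phi t) - mean (fun t => f k t * phi t) =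
    mean (fun t => (f k.+1 t - f k t) * phi t).
  move=> cphi; rewrite -meanB; last 2 first.
  - by apply: continuous_mulr => //; exact: isC2_continuous.
  - by apply: continuous_mulr => //; exact: isC2_continuous.
  by apply: eq_mean => t; rewrite mulrBl.
exists c, (2 `^ q * 2), N, f; split=> //.
- by split=> // k; have [] := nxtP (F k, k).
- split=> // k phi b Cphi; rewrite meanB_mul; last exact: C2_continuous Cphi.
  have [_ _ _ h _] := nxtP (F k, k).
  apply: (le_trans (h phi b Cphi)); rewrite mulrAC ler_wpM2r ?(C2_ge0 Cphi)//.
  exact: le_trans (eps_le k) (quarter k).
move=> a s K us.
pose d k n := mean (fun t => (f k.+1 t - f k t) * wave n a t).
have fE n : mean (fun t => f K t * wave n a t) =
    mean (wave n a) + \sum_(k < K) d k n.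
  elim: K => [|K ih].
    by rewrite big_ord0 addr0; apply: eq_mean => t; rewrite mul1r.
  rewrite big_ord_recr/= addrA -ih /d -meanB_mul ?subrKC//; exact: continuous_wave.
apply: (@le_trans _ _ (\sum_(n <- s) 2 `^ q * (`|mean (wave n a : R -> R)| `^ q +
    \sum_(k < K) (2 `^ q) ^+ k.+1 * `|d k n| `^ q))).
  apply: ler_sum => n _; rewrite fE.
  apply: (le_trans (powR_normD_le _ _ _)); first lra.
  rewrite ler_wpM2l ?powR_ge0// lerD2l.
  by apply: (powR_norm_sum_le K (fun k => d k n)); lra.
(* One unit for the initial constant function, which only has frequency 0, and one for all
   increments together. *)
rewrite -mulr_sumr ler_wpM2l ?powR_ge0// big_split/= -[leRHS]/(1 + 1 : R); apply: lerD.
  have h (n : int) : n != 0 -> `|mean (wave n a : R -> R)| `^ q = 0.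
    by move=> n0; rewrite mean_wave// normr0 powR0//; lra.
  have [s0|s0] := boolP (0 \in s); last first.
    rewrite big_seq big1 ?ler01// => n ns; apply: h.
    by apply: contraNneq s0 => <-.
  rewrite (bigD1_seq 0)//= big1 ?addr0//.
  rewrite (@eq_mean _ _ (fun=> cos a)) => [|t]; last by rewrite /wave mul0r add0r.
  have one_q : 1 `^ q = 1 :> R by rewrite powR1.
  rewrite mean_cst -[leRHS]one_q; apply: ge0_ler_powR; rewrite ?nnegrE ?cos_max//.
  lra.
rewrite exchange_big/=; apply: (@le_trans _ _ (\sum_(k < K) 1 * 2^-1 ^+ k.+1)).
  apply: ler_sum => k _; rewrite -mulr_sumr.
  apply: (@le_trans _ _ ((2 `^ q) ^+ k.+1 * eps k)).
    rewrite ler_wpM2l ?exprn_ge0 ?powR_ge0//.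
    by have [_ _ _ _ h] := nxtP (F k, nat_of_ord k); exact: h.
  rewrite epsE; apply: (le_trans (quarter k)).
  by rewrite ler_wpM2r ?exprn_ge0//; lra.
exact: sum_half_pow.
Qed.

End ConstructionSequence.

(** * The circle as a compact quotient *)

Section CircleTopology.
Context {R : realType}.
Implicit Types (t : R) (x : circle R) (n k : int).

Lemma repr_circle_proj t :
  exists k : int, repr (circle_proj t) = t + k%:~R * (2 * pi).
Proof.
have /circle_projP/intrP[k kE] := circle_projK (circle_proj t); exists k.
by rewrite -kE divfK ?(addrC t) ?subrK // gt_eqF ?twopi_gt0.
Qed.

Lemma circle_projD t k : circle_proj (t + k%:~R * (2 * pi)) = circle_proj t.
Proof.
apply/circle_projP; rewrite addrC addKr mulfK ?gt_eqF ?twopi_gt0// intr_int.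
Qed.

Lemma exists_representative t :
  exists k : int, 0 <= t + k%:~R * (2 * pi) <= 2 * pi.
Proof.
exists (- Num.floor (t / (2 * pi))); rewrite mulrNz mulNr.
have p0 := @twopi_gt0 R.
have /andP[h1 h2] := floor_itv (t / (2 * pi)).
rewrite ler_pdivlMr// in h1; rewrite ltr_pdivrMr// intrD mulrDl mul1r in h2.
by apply/andP; split; lra.
Qed.

Lemma circle_proj_continuous : continuous (@circle_proj R).
Proof. exact: pi_continuous. Qed.

Lemma compact_circle : compact [set: circle R].
Proof.
have -> : [set: circle R] = circle_proj @` `[0, 2 * pi].
  apply/seteqP; split=> // x _.
  have [k kE] := exists_representative (repr x).
  by exists (repr x + k%:~R * (2 * pi)); rewrite ?circle_projD ?circle_projK//= in_itv.
apply: continuous_compact; last exact: segment_compact.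
by apply: continuous_subspaceT; exact: circle_proj_continuous.
Qed.

Definition cwave n (a : R) x : R := wave n a (repr x).

Lemma cwave_proj n (a : R) t : cwave n a (circle_proj t) = wave n a t.
Proof. by rewrite /cwave; have [k ->] := repr_circle_proj t; exact: wave_periodic. Qed.

Lemma continuous_cwave n (a : R) : continuous (cwave n a).
Proof.
apply/quotient_continuous; rewrite (_ : _ \o _ = wave n a).
  exact: continuous_wave.
by apply/funext => t; exact: cwave_proj.
Qed.

Definition carrier_sum (M N : nat) x : R := \sum_(j < N) cwave (M * 5 ^ j)%N 0 x.

Lemma carrier_sum_proj (M N : nat) t :
  carrier_sum M N (circle_proj t) = \sum_(j < N) carrier M j t.
Proof. by apply: eq_bigr => j _; exact: cwave_proj. Qed.

Lemma continuous_carrier_sum (M N : nat) : continuous (carrier_sum M N).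
Proof. by apply: continuous_sumr => j; exact: continuous_cwave. Qed.

End CircleTopology.

(** * Smooth functions on the circle as periodic functions *)

Section TestFunctions.
Context {R : realType}.
Implicit Types (t : R) (phi : circle R -> R[i]) (g : R -> R).

Definition cinfty_periodic g : Prop :=
  (forall n t, derivable (derive1n n g) t 1) /\
  (forall t (k : int), g (t + k%:~R * (2 * pi)) = g t).

Lemma cinfty_periodic_derive1n n g t (k : int) : cinfty_periodic g ->
  derive1n n g (t + k%:~R * (2 * pi)) = derive1n n g t.
Proof.
move=> [dg pg]; elim: n t => [|n ih] t; first exact: pg.
set h : R -> R := derive1n n g in ih *.
have dh (u : R) : is_derive u (1 : R) h (derive1 h u) by rewrite derive1E; apply: derivableP; exact: dg.
have ds : is_derive t (1 : R) (fun u : R => u + k%:~R * (2 * pi)) (1 : R).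
  have := is_derive1D (is_derive_id t (1 : R)) (is_derive_cst (k%:~R * (2 * pi)) t (1 : R)).
  by rewrite addr0.
have d2 := @is_derive1_comp R h (fun u : R => u + k%:~R * (2 * pi)) t _ _ (dh _) ds.
have hE : h \o (fun u => u + k%:~R * (2 * pi)) = h by apply/funext => u; exact: ih.
rewrite hE mulr1 in d2; rewrite derive1nS -/h.
by rewrite -(@derive_val _ _ _ _ _ _ _ d2) derive1E.
Qed.

Lemma cinfty_periodic_bounded n g : cinfty_periodic g ->
  exists b, forall t, `|derive1n n g t| <= b.
Proof.
move=> Cg; pose h : R -> R := derive1n n g.
have ch : continuous h.
  apply: (@is_derive1_continuous _ _ (derive1 h)) => t.
  by rewrite derive1E; apply: derivableP; exact: (Cg.1 n t).
have [c _ hc] := @EVT_max R (fun t => `|h t|) 0 (2 * pi) (ltW (@twopi_gt0 R))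
  (continuous_subspaceT (fun t => cvg_norm (ch t))).
exists `|h c| => t; have [k kE] := exists_representative t.
by rewrite -(cinfty_periodic_derive1n n t k Cg); apply: hc; rewrite in_itv.
Qed.

Lemma cinfty_periodic_C2 g b : cinfty_periodic g ->
  (forall (n : 'I_3) t, `|derive1n n g t| <= b) -> C2 b g.
Proof.
move=> Cg bg; have [dg pg] := Cg.
have dn n (t : R) : is_derive t (1 : R) (derive1n n g) (derive1n n.+1 g t).
  by rewrite derive1nS derive1E; apply: derivableP.
exists (derive1n 1 g), (derive1n 2 g); split.
- exact: (dn 0%N).
- exact: (dn 1%N).
- exact: is_derive1_continuous (dn 2).
- have e n : derive1n n g (2 * pi) = derive1n n g 0.
    by rewrite -(cinfty_periodic_derive1n n 0 1 Cg) mul1r add0r.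
  by split; [exact: (e 0%N) | exact: (e 1%N)].
- move=> t; split; [exact: (bg (@Ordinal 3 0 isT) t)|exact: (bg (@Ordinal 3 1 isT) t)|].
  exact: (bg (@Ordinal 3 2 isT) t).
Qed.

Lemma smooth_cinfty phi : smooth phi ->
  cinfty_periodic (lift_Re phi) /\ cinfty_periodic (lift_Im phi).
Proof.
move=> sphi; split; split=> [n t|t k].
- by case: (sphi n t).
- by rewrite /lift_Re circle_projD.
- by case: (sphi n t).
- by rewrite /lift_Im circle_projD.
Qed.

Lemma norm_Re_le_normc (z : R[i]) : `|complex.Re z| <= normc z.
Proof.
case: z => a b /=; rewrite -sqrtr_sqr ler_sqrt ?addr_ge0 ?sqr_ge0// lerDl.
exact: sqr_ge0.
Qed.

Lemma norm_Im_le_normc (z : R[i]) : `|complex.Im z| <= normc z.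
Proof.
case: z => a b /=; rewrite -sqrtr_sqr ler_sqrt ?addr_ge0 ?sqr_ge0// lerDr.
exact: sqr_ge0.
Qed.

Lemma normc_le (z : R[i]) : normc z <= `|complex.Re z| + `|complex.Im z|.
Proof.
case: z => a b /=; rewrite -[leRHS]ger0_norm ?addr_ge0// -sqrtr_sqr ler_sqrt ?sqr_ge0//.
rewrite sqrrD !real_normK ?num_real// lerD2r lerDl mulrn_wge0//.
Qed.

Lemma sup_cderive_ub n phi t : smooth phi -> normc (cderive n phi t) <= sup_cderive n phi.
Proof.
move=> /smooth_cinfty[cR cI]; apply: ub_le_sup; last by exists t.
have [a ab] := cinfty_periodic_bounded n cR; have [b bb] := cinfty_periodic_bounded n cI.
by exists (a + b) => _ [u _ <-]; apply: (le_trans (normc_le _)); exact: lerD (ab u) (bb u).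
Qed.

Lemma smooth_C2 phi : smooth phi ->
  C2 (\sum_(n < 3) sup_cderive n phi) (lift_Re phi) /\
  C2 (\sum_(n < 3) sup_cderive n phi) (lift_Im phi).
Proof.
move=> sphi; have [cR cI] := smooth_cinfty sphi.
have h (n : 'I_3) t : normc (cderive n phi t) <= \sum_(m < 3) sup_cderive m phi.
  apply: (le_trans (sup_cderive_ub n t sphi)); rewrite (bigD1 n)//= lerDl.
  apply: sumr_ge0 => m _; apply: le_trans (sup_cderive_ub m 0 sphi).
  by apply: le_trans (norm_Re_le_normc _).
split; apply: cinfty_periodic_C2 => // n t; apply: le_trans (h n t).
- exact: (norm_Re_le_normc (cderive n phi t)).
- exact: (norm_Im_le_normc (cderive n phi t)).
Qed.

Lemma smooth1 : smooth (fun=> 1 : R[i]).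
Proof.
have e n (c : R) : exists d : R, derive1n n (fun=> c) = (fun=> d).
  elim: n => [|n [d ih]]; first by exists c.
  exists 0; rewrite derive1nS ih; apply/funext => t; rewrite derive1E.
  exact: derive_cst.
move=> n t; split.
- by have [d ->] : exists d : R, derive1n n (lift_Re (fun=> 1)) = (fun=> d) := e n 1.
- by have [d ->] : exists d : R, derive1n n (lift_Im (fun=> 1)) = (fun=> d) := e n 0.
Qed.

End TestFunctions.

(** * The limit distribution, its support and its coefficients *)

Section LimitDistribution.
Local Open Scope complex_scope.
Local Open Scope ring_scope.
Context {R : realType}.
Variables (q c C : R) (N : nat -> nat) (f : nat -> R -> R).
Hypotheses (q2 : 2 < q) (Cf : forall k, isC2 (f k)) (f0 : forall t, f 0%N t = 1).
Hypothesis f_vanish : forall k m t, (k < m)%N ->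
  \sum_(j < N k) carrier k.+1 j t <= c * (N k)%:R -> f m t = 0.
Hypothesis f_increment : forall k (phi : R -> R) b, C2 b phi ->
  `|mean (fun t => f k.+1 t * phi t) - mean (fun t => f k t * phi t)|
    <= 2^-1 * b * 2^-1 ^+ k.+1.
Hypothesis f_coef : forall (a : R) (s : seq int) K, uniq s ->
  \sum_(n <- s) `|mean (fun t => f K t * wave n a t)| `^ q <= C.
Implicit Types (g h : R -> R) (phi psi : circle R -> R[i]) (t : R).

Let q_gt0 : 0 < q. Proof. by move: q2; lra. Qed.

Definition limit_mean g : R := limn (fun k => mean (fun t => f k t * g t)).

Lemma cvg_limit_mean g : isC2 g ->
  mean (fun t => f k t * g t) @[k --> \oo] --> limit_mean g.
Proof. by move=> [b Cg]; case: (cvg_half_increments (fun k => f_increment k Cg)). Qed.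

Lemma limit_mean_le b g : C2 b g -> `|limit_mean g - mean g| <= 2^-1 * b.
Proof.
move=> Cg; case: (cvg_half_increments (fun k => f_increment k Cg)) => _.
rewrite -/(limit_mean g); congr (`|_ - _| <= _); apply: eq_mean => t.
by rewrite f0 mul1r.
Qed.

Lemma limit_meanD g h : isC2 g -> isC2 h ->
  limit_mean (fun t => g t + h t) = limit_mean g + limit_mean h.
Proof.
move=> Cg Ch; apply: cvg_lim => //.
rewrite (_ : (fun k => _) = (fun k => mean (fun t => f k t * g t) +
    mean (fun t => f k t * h t))).
  by apply: cvgD; exact: cvg_limit_mean.
apply/funext => k; rewrite -meanD; [|exact: isC2_continuous (isC2M _ _)..].
by apply: eq_mean => t; rewrite mulrDr.
Qed.

Lemma limit_meanZ (a : R) g : isC2 g -> limit_mean (fun t => a * g t) = a * limit_mean g.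
Proof.
move=> Cg; apply: cvg_lim => //.
rewrite (_ : (fun k => _) = (fun k => a * mean (fun t => f k t * g t))).
  by apply: cvgMr; exact: cvg_limit_mean.
apply/funext => k; rewrite -meanZ; last exact: isC2_continuous (isC2M _ _).
by apply: eq_mean => t; rewrite mulrCA.
Qed.

(** The factor 2 pi undoes the normalisation of [mean], so that [dist_fourier] reads off limits of
    means. *)
Definition limit_functional phi : R[i] :=
  (2 * pi * limit_mean (lift_Re phi)) +i* (2 * pi * limit_mean (lift_Im phi)).

Lemma smooth_isC2 phi : smooth phi -> isC2 (lift_Re phi) /\ isC2 (lift_Im phi).
Proof. by move=> /smooth_C2[CR CI]; split; eexists; [exact: CR | exact: CI]. Qed.

Lemma limit_functional_linear (a : R[i]) phi psi : smooth phi -> smooth psi ->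
  limit_functional (fun x => a * phi x + psi x) =
  a * limit_functional phi + limit_functional psi.
Proof.
move=> /smooth_isC2[pR pI] /smooth_isC2[sR sI]; case: a => a b.
rewrite /limit_functional.
have -> : lift_Re (fun x => (a +i* b) * phi x + psi x) =
    fun t => (a * lift_Re phi t + - b * lift_Im phi t) + lift_Re psi t.
  apply/funext => t; rewrite /lift_Re /lift_Im.
  by case: (phi _) => u v; case: (psi _) => u' v' /=; rewrite mulNr.
have -> : lift_Im (fun x => (a +i* b) * phi x + psi x) =
    fun t => (a * lift_Im phi t + b * lift_Re phi t) + lift_Im psi t.
  apply/funext => t; rewrite /lift_Re /lift_Im.
  by case: (phi _) => u v; case: (psi _) => u' v'.
have CZ x g : isC2 g -> isC2 (fun t => x * g t) by exact: isC2Z.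
have CD g h : isC2 g -> isC2 h -> isC2 (fun t => g t + h t) by exact: isC2D.
have -> : limit_mean (fun t => (a * lift_Re phi t + - b * lift_Im phi t) + lift_Re psi t) =
    (a * limit_mean (lift_Re phi) + - b * limit_mean (lift_Im phi)) +
    limit_mean (lift_Re psi).
  by rewrite !limit_meanD ?limit_meanZ//; try apply: CD; try apply: CZ.
have -> : limit_mean (fun t => (a * lift_Im phi t + b * lift_Re phi t) + lift_Im psi t) =
    (a * limit_mean (lift_Im phi) + b * limit_mean (lift_Re phi)) +
    limit_mean (lift_Im psi).
  by rewrite !limit_meanD ?limit_meanZ//; try apply: CD; try apply: CZ.
rewrite /=; move: (limit_mean (lift_Re phi)) (limit_mean (lift_Im phi)).
move: (limit_mean (lift_Re psi)) (limit_mean (lift_Im psi)) => u v x y.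
by congr (_ +i* _); ring.
Qed.

Lemma limit_functional_continuous : exists (B : R) (n : nat), forall phi, smooth phi ->
  normc (limit_functional phi) <= B * \sum_(m < n.+1) sup_cderive m phi.
Proof.
(* Each of the real and imaginary parts contributes 2 pi (1 + 1 / 2), and C^2 control means order
   2. *)
exists (6 * pi), 2%N => phi /smooth_C2; set b := \sum_(n < 3) _ => -[CR CI].
have p0 : 0 < pi :> R by exact: pi_gt0.
have h g : C2 b g -> `|2 * pi * limit_mean g| <= 3 * pi * b.
  move=> Cg; rewrite normrM ger0_norm ?(ltW twopi_gt0)//.
  have h1 := limit_mean_le Cg; have h2 : `|mean g| <= b.
    rewrite -[leRHS]mean_cst; apply: normr_mean.
    - exact: C2_continuous Cg.
    - by move=> t; exact: cvg_cst.
    - by move=> t; exact: C2_bounded Cg.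
  have h3 : `|limit_mean g| <= 3 / 2 * b.
    rewrite -(subrK (mean g) (limit_mean g)).
    by apply: (le_trans (ler_normD _ _)); lra.
  have := ler_wpM2l (ltW (@twopi_gt0 R)) h3.
  by move: `|limit_mean g| => x; lra.
apply: (le_trans (normc_le _)) => /=.
apply: (le_trans (lerD (h _ CR) (h _ CI))); rewrite -mulrDl /b.
by rewrite le_eqVlt; apply/orP; left; apply/eqP; congr (_ * _); ring.
Qed.

Definition limit_distribution : schwartz_distribution R :=
  SchwartzDistribution limit_functional_linear limit_functional_continuous.

Lemma limit_distribution_nonzero : dist_nonzero limit_distribution.
Proof.
exists (fun=> 1); first exact: smooth1.
have C1 : C2 1 (fun=> 1 : R).
  exists (fun=> 0), (fun=> 0); split=> // [t|t|t|t].
  - exact: is_derive_cst.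
  - exact: is_derive_cst.
  - exact: cvg_cst.
  - by rewrite normr0 normr1.
have := limit_mean_le C1; rewrite mean_cst mulr1 => h.
apply/negP => /eqP/(congr1 (@complex.Re R)) /= /eqP.
rewrite mulf_eq0 gt_eqF ?twopi_gt0//= => /eqP l0.
have : limit_mean (fun=> 1) = 0 by exact: l0.
by move=> l0'; rewrite l0' sub0r normrN normr1 in h; lra.
Qed.

Definition limit_set : set (circle R) :=
  [set x | forall k, c * (N k)%:R <= carrier_sum k.+1 (N k) x].

(** If condition k fails at x, it fails on a neighbourhood where every later f m vanishes, so test
    functions supported there are annihilated. *)
Lemma limit_distribution_supp : dist_supp limit_distribution `<=` limit_set.
Proof.
move=> x sx k; rewrite leNgt; apply/negP => xk.
pose U := [set y : circle R | carrier_sum k.+1 (N k) y < c * (N k)%:R].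
have oU : open U.
  have /continuousP := @continuous_carrier_sum R k.+1 (N k).
  by move=> /(_ _ (@open_lt R (c * (N k)%:R))).
have [phi [sphi phiU /negP]] := sx U oU xk; apply; apply/eqP.
have fphi t : U (circle_proj t) \/ phi (circle_proj t) = 0.
  have [->|p0] := eqVneq (phi (circle_proj t)) 0; [by right | left].
  by apply: phiU; apply: subset_closure.
have lim0 g : (forall t, U (circle_proj t) \/ g t = 0) -> limit_mean g = 0.
  move=> Ug; apply: cvg_lim => //; apply: cvg_near_cst.
  exists k.+1 => // m /= km; rewrite -[RHS](mean_cst 0); apply: eq_mean => t.
  have [Ut|->] := Ug t; last by rewrite mulr0.
  rewrite (f_vanish km) ?mul0r//.
  by rewrite -carrier_sum_proj ltW.
by rewrite /limit_distribution /= /limit_functional !lim0 ?mulr0// => t;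
  case: (fphi t) => [|e]; [left | right; rewrite /lift_Im /lift_Re e | left |
  right; rewrite /lift_Im /lift_Re e].
Qed.

Lemma closed_limit_set : closed limit_set.
Proof.
have -> : limit_set = \bigcap_k [set x | c * (N k)%:R <= carrier_sum k.+1 (N k) x].
  by apply/seteqP; split=> x h k; [move=> _; exact: h | exact: (h k I)].
apply: closed_bigI => k _.
have /continuous_closedP := @continuous_carrier_sum R k.+1 (N k).
by move=> /(_ _ (@closed_ge R (c * (N k)%:R))).
Qed.

Lemma limit_set_compact : compact limit_set.
Proof. exact: subclosed_compact closed_limit_set compact_circle _. Qed.

(** On a finite s some stage is within total distance 1 of the limit; each difference is then at
    most 1 and dominates its own q-th power. *)
Lemma sum_limit_coef_le (a : R) (s : seq int) : uniq s ->
  \sum_(n <- s) `|limit_mean (wave n a)| `^ q <= 2 `^ q * (C + 1).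
Proof.
move=> us; pose u k n := mean (fun t => f k t * wave n a t).
have cvg0 : (fun k => \sum_(n <- s) `|limit_mean (wave n a) - u k n|) @ \oo --> (0 : R).
  elim: s {us} => [|n s ih].
    by under eq_fun do rewrite big_nil; exact: cvg_cst.
  under eq_fun do rewrite big_cons.
  have hn : (fun k => `|limit_mean (wave n a) - u k n|) @ \oo --> (0 : R).
    have -> : 0 = `|limit_mean (wave n a) - limit_mean (wave n a)| by rewrite subrr normr0.
    by apply: cvg_norm; apply: cvgB; [exact: cvg_cst | exact/cvg_limit_mean/isC2_wave].
  have := cvgD hn ih; rewrite addr0; exact.
have [k _ /(_ k (leqnn k))] := cvgr_dist_le _ _ cvg0 _ ltr01.
rewrite sub0r normrN ger0_norm ?sumr_ge0// => dk.
apply: (@le_trans _ _ (\sum_(n <- s) 2 `^ q *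
    (`|u k n| `^ q + `|limit_mean (wave n a) - u k n|))).
  rewrite big_seq [leRHS]big_seq; apply: ler_sum => n ns.
  rewrite -{1}(subrKC (u k n) (limit_mean (wave n a))).
  apply: (le_trans (powR_normD_le _ _ (ltW q_gt0))).
  rewrite ler_wpM2l ?powR_ge0// lerD2l.
  have [->|d0] := eqVneq (limit_mean (wave n a) - u k n) 0.
    by rewrite normr0 powR0// gt_eqF.
  apply: ge1r_powR; last by move: q2; lra.
  rewrite normr_gt0 d0/=; apply: le_trans dk.
  by rewrite (bigD1_seq n)//= lerDl sumr_ge0.
rewrite -mulr_sumr ler_wpM2l ?powR_ge0// big_split/= lerD//.
exact: f_coef.
Qed.

Lemma limit_distribution_fourier n : dist_fourier limit_distribution n =
  limit_mean (wave n 0) +i* limit_mean (wave n (pi / 2)).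
Proof.
rewrite /dist_fourier /= /limit_functional.
have -> : lift_Re (expit (- n)) = (wave n 0 : R -> R).
  apply/funext => t; rewrite /lift_Re expit_proj /wave/=.
  by rewrite mulrNz mulNr cosN addr0.
have -> : lift_Im (expit (- n)) = (wave n (pi / 2) : R -> R).
  apply/funext => t; rewrite /lift_Im expit_proj /wave/=.
  by rewrite mulrNz mulNr sinN cosDpihalf.
have p0 : 2 * pi != 0 :> R by rewrite gt_eqF ?twopi_gt0.
by congr (_ +i* _) => /=; rewrite !mul0r ?subr0 ?addr0 mulKf.
Qed.

Lemma limit_distribution_ell_q : ell_q q (dist_fourier limit_distribution).
Proof.
have q0 : 0 <= q by exact: ltW.
pose B := 2 `^ q * (2 `^ q * (C + 1) + 2 `^ q * (C + 1)).
apply: (@le_lt_trans _ _ B%:E); last exact: ltry.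
apply: ub_ereal_sup => _ [F [finF _] <-].
rewrite fsbig_finite// sumEFin lee_fin.
move: (finmap.enum_fset _) (finmap.fset_uniq (fset_set F)) => s us.
apply: (@le_trans _ _ (\sum_(n <- s) 2 `^ q *
    (`|limit_mean (wave n 0)| `^ q + `|limit_mean (wave n (pi / 2))| `^ q))).
  apply: ler_sum => n _; rewrite limit_distribution_fourier.
  set x := limit_mean _; set y := limit_mean _.
  apply: (@le_trans _ _ (`| `|x| + `|y| | `^ q)).
    apply: ge0_ler_powR => //; rewrite ?nnegrE//; first exact: sqrtr_ge0.
    by rewrite [leRHS]ger0_norm ?addr_ge0//; exact: (normc_le (x +i* y)).
  by apply: (le_trans (powR_normD_le _ _ _)) => //; rewrite !normr_id.
rewrite -mulr_sumr ler_wpM2l ?powR_ge0// big_split/=.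
by apply: lerD; apply: sum_limit_coef_le; exact: us.
Qed.

End LimitDistribution.

(** * Integration of bounded measurable functions *)

Section BoundedMeasurable.
Context d (T : measurableType d) (R : realType).
Implicit Types (g h : T -> R) (m : {finite_measure set T -> \bar R}).

Definition bounded_measurable g : Prop :=
  measurable_fun setT g /\ exists b, forall x, `|g x| <= b.

Lemma bounded_measurable_cst (a : R) : bounded_measurable (fun=> a).
Proof. by split; [exact: measurable_cst | exists `|a|]. Qed.

Lemma bounded_measurableD g h : bounded_measurable g -> bounded_measurable h ->
  bounded_measurable (fun x => g x + h x).
Proof.
move=> [mg [a ga]] [mh [b hb]]; split; first exact: measurable_funD.
by exists (a + b) => x; apply: (le_trans (ler_normD _ _)); exact: lerD.
Qed.

Lemma bounded_measurableM g h : bounded_measurable g -> bounded_measurable h ->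
  bounded_measurable (fun x => g x * h x).
Proof.
move=> [mg [a ga]] [mh [b hb]]; split; first exact: measurable_funM.
by exists (a * b) => x; rewrite normrM; exact: ler_pM.
Qed.

Lemma bounded_measurable_norm g : bounded_measurable g ->
  bounded_measurable (fun x => `|g x|).
Proof.
move=> [mg [a ga]]; split; first exact: (measurableT_comp _ mg).
by exists a => x; rewrite normr_id.
Qed.

Lemma bounded_measurable_indic (A : set T) : measurable A -> bounded_measurable \1_A.
Proof.
move=> mA; split; first exact: measurable_indic.
by exists 1 => x; rewrite indicE; case: (_ \in _); rewrite ?normr1 ?normr0.
Qed.

Lemma bounded_measurable_integrable m g : bounded_measurable g ->
  m.-integrable setT (EFin \o g).
Proof.
move=> [mg [b gb]]; apply: measurable_bounded_integrable => //.
  by rewrite ltey_eq fin_num_measure.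
exists b; split; first exact: num_real.
by move=> M bM x _ /=; exact: le_trans (gb x) (ltW bM).
Qed.

Lemma bounded_measurable_sum (I : Type) (s : seq I) (F : I -> T -> R) :
  (forall i, bounded_measurable (F i)) ->
  bounded_measurable (fun x => \sum_(i <- s) F i x).
Proof.
move=> bF; elim: s => [|i s ih].
  by under eq_fun do rewrite big_nil; exact: bounded_measurable_cst.
under eq_fun do rewrite big_cons.
by apply: bounded_measurableD; [exact: bF | exact: ih].
Qed.

Lemma Rintegral_sum m (I : Type) (s : seq I) (F : I -> T -> R) :
  (forall i, bounded_measurable (F i)) ->
  \int[m]_x (\sum_(i <- s) F i x) = \sum_(i <- s) \int[m]_x F i x.
Proof.
move=> bF; elim: s => [|i s ih].
  transitivity (\int[m]_x (0 : R)); last by rewrite big_nil Rintegral_cst// mul0r.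
  by apply: eq_Rintegral => x _; rewrite big_nil.
rewrite big_cons -ih -RintegralD//.
- by apply: eq_Rintegral => x _; rewrite big_cons.
- exact: bounded_measurable_integrable.
- by apply: bounded_measurable_integrable; exact: bounded_measurable_sum.
Qed.

(** Convergence in L^1 rather than of integrals, so that it stays uniform after multiplication by
    waves of any frequency. *)
Lemma bounded_cvg_Rintegral m (g_ : nat -> T -> R) g (b : R) :
  (forall k, bounded_measurable (g_ k)) -> (forall k x, `|g_ k x| <= b) ->
  (forall x, g_ k x @[k --> \oo] --> g x) ->
  bounded_measurable g /\ \int[m]_x `|g_ k x - g x| @[k --> \oo] --> (0 : R).
Proof.
move=> bg gb g_g.
have mg : measurable_fun setT g.
  by apply: (@measurable_fun_cvg _ _ _ _ g_) => // k; case: (bg k).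
have gle x : `|g x| <= b.
  have h : `|g_ k x| @[k --> \oo] --> `|g x| by apply: cvg_norm; exact: g_g.
  rewrite -(cvg_lim _ h)//; apply: limr_le.
    by apply/cvg_ex; eexists; exact: h.
  by near=> k; exact: gb.
split; first by split=> //; exists b.
have [|||||_ h _] := @dominated_convergence _ _ _ m setT measurableT
  (fun k => EFin \o g_ k) (EFin \o g) (cst b%:E).
- by move=> k; apply/measurable_EFinP; case: (bg k).
- exact/measurable_EFinP.
- by apply: aeW => x _; apply: cvg_EFin; [near=> k | exact: g_g].
- by have := @bounded_measurable_integrable m _ (bounded_measurable_cst b).
- by apply: aeW => x k _ /=; rewrite lee_fin.
exact: (fine_cvg h).
Unshelve. all: by end_near. Qed.

End BoundedMeasurable.

(** * Polynomial approximation of |h| and of the indicator of h > 0 *)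

Section AbsApproximation.
Context {R : realType}.
Implicit Types (h x : R).

(* The iterates of the square root algorithm, polynomials increasing to |h| on [-1, 1]. *)
Fixpoint abs_approx (k : nat) h : R :=
  if k is k'.+1 then abs_approx k' h + 2^-1 * (h * h - abs_approx k' h * abs_approx k' h)
  else 0.

(** One step multiplies the error by 1 - (|h| + p) / 2, which lies between 0 and 1 - |h| / 2. *)
Lemma abs_approx_bounds k h : `|h| <= 1 ->
  0 <= abs_approx k h <= `|h| /\ `|h| - abs_approx k h <= `|h| * (1 - `|h| / 2) ^+ k.
Proof.
move=> h1; have h0 : 0 <= `|h| by [].
have hh : h * h = `|h| * `|h| by rewrite -normrM ger0_norm// -expr2 sqr_ge0.
elim: k => [|k [/andP[p0 ph] ih]] /=; first by rewrite expr0 mulr1 subr0 !lexx h0.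
set p := abs_approx k h in p0 ph ih *; rewrite hh exprS.
have e : `|h| - (p + 2^-1 * (`|h| * `|h| - p * p)) =
    (`|h| - p) * (1 - (`|h| + p) / 2) by field.
have d0 : 0 <= `|h| - p by rewrite subr_ge0.
have f0 : 0 <= 1 - (`|h| + p) / 2 by lra.
have sq : p * p <= `|h| * `|h| by exact: ler_pM.
split; last first.
  rewrite e mulrCA mulrC; apply: ler_pM => //; lra.
apply/andP; split; first lra.
by rewrite -subr_ge0 e mulr_ge0.
Qed.

Lemma abs_approx_cvg h : `|h| <= 1 -> abs_approx k h @[k --> \oo] --> `|h|.
Proof.
move=> h1; have [h0|h0] := eqVneq `|h| 0.
  rewrite h0; apply: cvg_near_cst; near=> k.
  have [/andP[p0 +] _] := abs_approx_bounds k h1.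
  by rewrite h0 => p1; apply/eqP; rewrite eq_le p0 p1.
have hp : 0 < `|h| by rewrite lt_def h0 normr_ge0.
apply: (@squeeze_cvgr _ _ _ _ (fun k => `|h| - `|h| * (1 - `|h| / 2) ^+ k)
  (fun=> `|h|)).
- near=> k; have [/andP[_ p1] h2] := abs_approx_bounds k h1.
  by rewrite p1 andbT; lra.
- rewrite -[X in _ --> X]subr0; apply: cvgB; first exact: cvg_cst.
  rewrite -(mulr0 `|h|); apply: cvgMr; apply: cvg_expr.
  by rewrite ger0_norm; lra.
- exact: cvg_cst.
Unshelve. all: by end_near. Qed.

Lemma indicator_gt0_cvg h : `|h| <= 1 ->
  1 - (1 - 2^-1 * (h + `|h|)) ^+ k @[k --> \oo] --> ((0 < h)%R%:R : R).
Proof.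
move=> h1; have [h0|h0] := ltP 0 h.
  rewrite gtr0_norm// -[X in _ --> X]subr0; apply: cvgB; first exact: cvg_cst.
  apply: cvg_expr; rewrite gtr0_norm in h1 => //.
  by rewrite ger0_norm; lra.
rewrite ler0_norm// subrr mulr0 subr0.
by under eq_fun do rewrite expr1n subrr; exact: cvg_cst.
Qed.

End AbsApproximation.

(** * Borel measurability of continuous functions *)

Section BorelCircle.
Context {R : realType}.
Let T := borel_circle R.

Lemma continuous_borel (g : circle R -> R) : continuous g ->
  measurable_fun [set: T] (g : T -> R).
Proof.
move=> cg; apply: (measurability _ (RGenOInfty.measurableE R)) => //.
move=> _ [_ [x ->] <-]; rewrite setTI; apply: sub_sigma_algebra.
by move/continuousP: cg; apply; exact: interval_open.
Qed.

Lemma bounded_measurable_cwave n (a : R) : bounded_measurable (cwave n a : T -> R).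
Proof.
split; first by apply: continuous_borel; exact: continuous_cwave.
by exists 1 => x; exact: normr_wave.
Qed.

End BorelCircle.

(** * Multipliers preserving the decay of coefficients *)

Section VanishingCoefficients.
Context {R : realType}.
Let T := borel_circle R.
Variables m1 m2 : {finite_measure set T -> \bar R}.
Implicit Types (g h u v : T -> R) (a b r : R) (A : set T).

Definition signed_integral g : R := \int[m1]_x g x - \int[m2]_x g x.

Let bmi (m : {finite_measure set T -> \bar R}) g :
  bounded_measurable g -> m.-integrable setT (EFin \o g).
Proof. exact: bounded_measurable_integrable. Qed.

Lemma signed_integralD g h : bounded_measurable g -> bounded_measurable h ->
  signed_integral (fun x => g x + h x) = signed_integral g + signed_integral h.
Proof.
by move=> bg bh; rewrite /signed_integral !RintegralD//; try exact: bmi; ring.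
Qed.

Lemma signed_integralZ a g : bounded_measurable g ->
  signed_integral (fun x => a * g x) = a * signed_integral g.
Proof.
by move=> bg; rewrite /signed_integral !RintegralZl ?mulrBr//; exact: bmi.
Qed.

Lemma signed_integral_le g h : bounded_measurable g -> bounded_measurable h ->
  (forall x, `|g x| <= h x) ->
  `|signed_integral g| <= \int[m1]_x h x + \int[m2]_x h x.
Proof.
move=> bg bh gh; apply: (le_trans (ler_normB _ _)).
have le (m : {finite_measure set T -> \bar R}) : `|\int[m]_x g x| <= \int[m]_x h x.
  apply: (le_trans (le_normr_Rintegral _ _)) => //; first exact: bmi.
  apply: le_Rintegral => //; [|exact: bmi].
  by apply: bmi; exact: bounded_measurable_norm.
exact: lerD.
Qed.

(** All phases are required: they make the class stable under multiplication by a wave and account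
    for negative frequencies. *)
Definition coefs_vanish g : Prop := bounded_measurable g /\
  forall a, signed_integral (fun x => g x * cwave n%:Z a x) @[n --> \oo] --> (0 : R).

(** Quantifying over g makes multipliers compose, hence closed under products. *)
Definition multiplier u : Prop := forall g, coefs_vanish g ->
  coefs_vanish (fun x => u x * g x).

Let bmw n a := @bounded_measurable_cwave R n a.

Lemma coefs_vanishD g h : coefs_vanish g -> coefs_vanish h ->
  coefs_vanish (fun x => g x + h x).
Proof.
move=> [bg cg] [bh ch]; split=> [|a]; first exact: bounded_measurableD.
rewrite (_ : (fun n : nat => _) = (fun n : nat =>
    signed_integral (fun x => g x * cwave n%:Z a x) +
    signed_integral (fun x => h x * cwave n%:Z a x))); last first.
  apply/funext => n; rewrite -signed_integralD; try exact: bounded_measurableM.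
  by congr signed_integral; apply/funext => x; rewrite mulrDl.
by rewrite -[X in _ --> X]addr0; apply: cvgD.
Qed.

Lemma coefs_vanishZ b g : coefs_vanish g -> coefs_vanish (fun x => b * g x).
Proof.
move=> [bg cg]; split=> [|a].
  by apply: bounded_measurableM => //; exact: bounded_measurable_cst.
rewrite (_ : (fun n : nat => _) = (fun n : nat =>
    b * signed_integral (fun x => g x * cwave n%:Z a x))); last first.
  apply/funext => n; rewrite -signed_integralZ; last exact: bounded_measurableM.
  by congr signed_integral; apply/funext => x; rewrite mulrA.
by rewrite -(mulr0 b); apply: cvgMr.
Qed.

Lemma multiplier_cst b : multiplier (fun=> b).
Proof. by move=> g; exact: coefs_vanishZ. Qed.

Lemma multiplierD u v : multiplier u -> multiplier v -> multiplier (fun x => u x + v x).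
Proof.
move=> mu mv g cg; under eq_fun do rewrite mulrDl.
by apply: coefs_vanishD; [exact: mu | exact: mv].
Qed.

Lemma multiplierM u v : multiplier u -> multiplier v -> multiplier (fun x => u x * v x).
Proof. by move=> mu mv g cg; under eq_fun do rewrite -mulrA; exact/mu/mv. Qed.

Lemma multiplierB u v : multiplier u -> multiplier v -> multiplier (fun x => u x - v x).
Proof.
move=> mu mv; have -> : (fun x => u x - v x) = (fun x => u x + -1 * v x).
  by apply/funext => x; rewrite mulN1r.
apply: multiplierD; first exact: mu.
by apply: multiplierM; [exact: multiplier_cst | exact: mv].
Qed.

Lemma multiplierX u k : multiplier u -> multiplier (fun x => u x ^+ k).
Proof.
move=> mu; elim: k => [|k ih]; first exact: multiplier_cst.
by under eq_fun do rewrite exprS; exact: multiplierM.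
Qed.

Lemma multiplier_cwave b : multiplier (cwave 1 b).
Proof.
move=> g [bg cg]; split=> [|a]; first exact: bounded_measurableM.
have l1 : signed_integral (fun x => g x * cwave n.+2%:Z (a + b) x) @[n --> \oo] --> (0 : R).
  by have := cg (a + b); rewrite -(cvg_shiftn 2); under eq_fun do rewrite addn2.
have : 2^-1 * (signed_integral (fun x => g x * cwave n.+2%:Z (a + b) x) +
    signed_integral (fun x => g x * cwave n%:Z (a - b) x)) @[n --> \oo] -->
    (2^-1 * (0 + 0) : R).
  by apply: cvgMr; apply: cvgD.
(* At index n + 1 the product formula gives frequencies n + 2 and n, both natural numbers. *)
rewrite addr0 mulr0 -[X in _ -> X](cvg_shiftn 1).
apply: cvg_trans; apply: near_eq_cvg; near=> n.
rewrite /= addn1 -signed_integralD; try exact: bounded_measurableM.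
rewrite -signed_integralZ; last by apply: bounded_measurableD; exact: bounded_measurableM.
congr signed_integral; apply/funext => x; rewrite /cwave.
transitivity (g x * (wave n.+1 a (repr x) * wave 1 b (repr x))); last by ring.
rewrite wave_mul.
have -> : n.+1%:Z + 1 = n.+2 by lia.
have -> : n.+1%:Z - 1 = n by lia.
by field.
Unshelve. all: by end_near.
Qed.

(** Some k makes the L^1 error at most e / 2 for all frequencies at once; only then is n taken large
    for that k. *)
Lemma multiplier_lim (u_ : nat -> T -> R) u b : (forall k, multiplier (u_ k)) ->
  (forall k x, `|u_ k x| <= b) -> (forall x, u_ k x @[k --> \oo] --> u x) ->
  multiplier u.
Proof.
move=> mu ub uu g cg; have [[mg [c gc]] _] := cg.
have [bug cug] : (forall k, bounded_measurable (fun x => u_ k x * g x)) /\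
    (forall k, coefs_vanish (fun x => u_ k x * g x)).
  by split=> k; [case: (mu k g cg) | exact: mu].
have lim m := @bounded_cvg_Rintegral _ T R m (fun k x => u_ k x * g x)
  (fun x => u x * g x) (b * c) bug.
have hb k x : `|u_ k x * g x| <= b * c by rewrite normrM ler_pM.
have hc x : u_ k x * g x @[k --> \oo] --> u x * g x by apply: cvgMl; exact: uu.
have [bg l1] := lim m1 hb hc; have [_ l2] := lim m2 hb hc.
split=> // a; apply/cvgrPdist_le => e e0.
have e2 : 0 < e / 2 by rewrite divr_gt0.
have l12 : (fun k => \int[m1]_x `|u_ k x * g x - u x * g x| +
    \int[m2]_x `|u_ k x * g x - u x * g x|) @ \oo --> (0 + 0 : R) by apply: cvgD.
rewrite addr0 in l12.
have [k _ /(_ k (leqnn k))] := cvgr_dist_le _ _ l12 _ e2.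
rewrite sub0r normrN => hk; have hk' := le_trans (ler_norm _) hk.
have [n0 _ ev] := cvgr_dist_le _ _ ((cug k).2 a) _ e2.
near=> n; rewrite sub0r normrN.
have bd : bounded_measurable (fun x => u_ k x * g x - u x * g x).
  apply: bounded_measurableD => //.
  have := bounded_measurableM (bounded_measurable_cst T (-1)) bg.
  by congr bounded_measurable; apply/funext => x; rewrite mulN1r.
have -> : signed_integral (fun x => u x * g x * cwave n a x) =
    -1 * signed_integral (fun x => (u_ k x * g x - u x * g x) * cwave n a x) +
    signed_integral (fun x => u_ k x * g x * cwave n a x).
  rewrite -signed_integralZ; last exact: bounded_measurableM.
  rewrite -signed_integralD; [|apply: bounded_measurableM => //|exact: bounded_measurableM].
  - by congr signed_integral; apply/funext => x; ring.
  - exact: bounded_measurable_cst.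
  - exact: bounded_measurableM.
apply: (le_trans (ler_normD _ _)); rewrite [leRHS](splitr e); apply: lerD.
  rewrite mulN1r normrN; apply: le_trans hk'; apply: signed_integral_le.
  - exact: bounded_measurableM.
  - exact: bounded_measurable_norm.
  - by move=> x; rewrite normrM ler_piMr// normr_wave.
near: n; exists n0 => // n /= n0n.
by have := ev n n0n; rewrite /= sub0r normrN.
Unshelve. all: by end_near. Qed.

(** The range of b gives |h| <= 1. A first limit yields |h|, and a second one the indicator, from
    the powers of 1 - max(h, 0). *)
Lemma multiplier_arc b r : -1 <= b <= 1 -> multiplier \1_[set x | b < cwave 1 r x].
Proof.
move=> /andP[b1 b2]; pose h x := 2^-1 * (cwave 1 r x - b).
have h1 x : `|h x| <= 1.
  have := normr_wave 1 r (repr x); rewrite -/(cwave 1 r x) ler_norml => /andP[w1 w2].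
  by rewrite ler_norml /h; apply/andP; split; lra.
have mh : multiplier h.
  apply: multiplierM; first exact: multiplier_cst.
  by apply: multiplierB; [exact: multiplier_cwave | exact: multiplier_cst].
have mabs : multiplier (fun x => `|h x|).
  apply: (@multiplier_lim (fun k x => abs_approx k (h x)) _ 1).
  - elim=> [|k ih] /=; first exact: multiplier_cst.
    apply: multiplierD; first exact: ih.
    apply: multiplierM; first exact: multiplier_cst.
    by apply: multiplierB; exact: multiplierM.
  - move=> k x; have [/andP[p0 p1] _] := abs_approx_bounds k (h1 x).
    by rewrite ger0_norm// (le_trans p1).
  - by move=> x; exact: abs_approx_cvg.
apply: (@multiplier_lim (fun k x => 1 - (1 - 2^-1 * (h x + `|h x|)) ^+ k) _ 1).
- move=> k; apply: multiplierB; first exact: multiplier_cst.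
  apply: multiplierX; apply: multiplierB; first exact: multiplier_cst.
  by apply: multiplierM; [exact: multiplier_cst | exact: multiplierD].
- move=> k x; have h2 := h1 x.
  have y0 : 0 <= 1 - 2^-1 * (h x + `|h x|).
    by have := ler_norm (h x); lra.
  have y1 : 1 - 2^-1 * (h x + `|h x|) <= 1.
    by have := lerNnormlW (lexx `|h x|); lra.
  have p0 := exprn_ge0 k y0; have p1 := exprn_ile1 k y0 y1.
  by rewrite ger0_norm; lra.
- move=> x; have := indicator_gt0_cvg (h1 x).
  rewrite indicE /h; congr (_ --> _); congr (nat_of_bool _)%:R.
  rewrite pmulr_rgt0// subr_gt0; apply/idP/idP => [bx|]; first exact/mem_set.
  by move/set_mem.
Qed.

Lemma sigma_algebra_multiplier : sigma_algebra setT [set A | multiplier \1_A].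
Proof.
split=> /= [|A mA|A mA].
- by rewrite indic0; exact: multiplier_cst.
- rewrite (_ : \1_(setT `\` A) = (fun x => 1 - \1_A x)).
    by apply: multiplierB => //; exact: multiplier_cst.
  apply/funext => x; rewrite !indicE setTD in_setC.
  by case: (x \in A); rewrite ?subrr ?subr0.
(* The indicator of a finite union as a polynomial in indicators; closure under products thus
   handles unions that are not disjoint. *)
- pose u k x : R := 1 - \prod_(i < k) (1 - \1_(A i) x).
  apply: (@multiplier_lim u _ 1) => [k|k x|x].
  + apply: multiplierB; first exact: multiplier_cst.
    elim: k => [|k ih].
      by under eq_fun do rewrite big_ord0; exact: multiplier_cst.
    under eq_fun do rewrite big_ord_recr/=.
    apply: multiplierM => //; apply: multiplierB; first exact: multiplier_cst.
    exact: mA.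
  + have f01 i : 0 <= (1 - \1_(A i) x : R) <= 1.
      by rewrite indicE; case: (x \in A i); rewrite ?subrr ?subr0 lexx ler01.
    have p : 0 <= (\prod_(i < k) (1 - \1_(A i) x) : R) <= 1.
      apply/andP; split; first by apply: prodr_ge0 => i _; case/andP: (f01 i).
      by apply: prodr_ile1 => i _; exact: f01.
    by case/andP: p => p0 p1; rewrite ger0_norm /u; lra.
  + apply: cvg_near_cst; have [[i _ Aix]|nA] := pselect ((\bigcup_k A k) x).
      exists i.+1 => // k /= ik; rewrite /u (bigD1 (Ordinal ik))//=.
      rewrite [\1_(A i) x]indicE mem_set// subrr mul0r subr0 indicE mem_set//.
      by exists i.
    near=> k; rewrite /u big1 ?subrr => [|i _].
      by rewrite indicE memNset.
    rewrite indicE memNset ?subr0// => Aix; apply: nA; by exists i.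
Unshelve. all: by end_near. Qed.

End VanishingCoefficients.

(** * A countable base of arcs *)

Section CircleBasis.
Context {R : realType}.
Implicit Types (x y : circle R) (U : set (circle R)).

Lemma continuous_lt_open (g : circle R -> R) (b : R) : continuous g ->
  open [set x | b < g x].
Proof. by move/continuousP => /(_ _ (@open_gt R b)). Qed.

Lemma ler_cos (s t : R) : 0 <= s -> s <= t -> t <= pi -> cos t <= cos s.
Proof.
move=> s0 st tpi; rewrite leNgt ltr_cos ?in_itv/= ?s0 ?tpi ?(le_trans s0 st) ?(le_trans st tpi)//.
by rewrite -leNgt.
Qed.

(** Arcs are superlevel sets of a shifted cosine, the form accepted by [multiplier_arc]; codes of no
    admissible pair give the empty set. *)
Definition rational_arc (n : nat) : set (circle R) :=
  if (unpickle n : option (rat * rat)) is Some (r, b) then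
    if -1 <= (ratr b : R) <= 1 then [set x | (ratr b : R) < cwave 1 (ratr r) x] else set0
  else set0.

Lemma open_rational_arc n : open (rational_arc n).
Proof.
rewrite /rational_arc; case: unpickle => [[r b]|]; last exact: open0.
case: ifP => _; last exact: open0.
by apply: continuous_lt_open; exact: continuous_cwave.
Qed.

Lemma rational_arc_basis U x : open U -> U x ->
  exists2 n, rational_arc n x & rational_arc n `<=` U.
Proof.
move=> oU Ux; pose t0 := repr x.
have : nbhs t0 (circle_proj @^-1` U).
  apply: (@circle_proj_continuous R t0); rewrite circle_projK.
  exact: open_nbhs_nbhs.
move=> /nbhs_ballP[e /= e0 eU].
pose d := Num.min e 1; have d0 : 0 < d by rewrite lt_min e0 ltr01.
have d1 : d <= 1 by rewrite ge_min lexx orbT.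
have de : d <= e by rewrite ge_min lexx.
have pi2 := @pi_ge2 R.
(* The centre - r is within d / 4 of t0, and the level b between cos (d / 2) and cos (d / 4) gives a
   half-width between d / 4 and d / 2. So the arc contains x and stays within d of it. *)
have [r] : exists r : rat, (ratr r : R) \in `]- t0 - d / 4, - t0 + d / 4[.
  by apply: rat_in_itvoo; lra.
rewrite in_itv/= => /andP[r1 r2].
have cosd : cos (d / 2) < cos (d / 4).
  by rewrite ltr_cos ?in_itv/=; [lra | apply/andP; split; lra..].
have [b] : exists b : rat, (ratr b : R) \in `]cos (d / 2), cos (d / 4)[.
  exact: rat_in_itvoo.
rewrite in_itv/= => /andP[b1 b2].
have c1 := cos_geN1 (d / 2); have c2 := cos_le1 (d / 4).
have b01 : -1 <= (ratr b : R) <= 1 by apply/andP; split; lra.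
have arcE : rational_arc (pickle (r, b)) = [set y | (ratr b : R) < cwave 1 (ratr r) y].
  by rewrite /rational_arc pickleK b01.
exists (pickle (r, b)); rewrite arcE /=.
  rewrite /cwave /wave mul1r -/t0 -cos_norm; apply: (lt_le_trans b2).
  have h : `|t0 + ratr r| <= d / 4 by rewrite ler_norml; apply/andP; split; lra.
  by apply: ler_cos => //; lra.
move=> y /=; rewrite /cwave /wave mul1r => by_.
(* Adding pi puts s + r into [- pi, pi], where the cosine determines the distance to 0. *)
have [k /andP[k1 k2]] := exists_representative (repr y + ratr r + pi).
set s := repr y + k%:~R * (2 * pi).
have sy : circle_proj s = y by rewrite circle_projD circle_projK.
rewrite -sy; apply: eU; rewrite /ball/=.
have cs : cos (s + ratr r) = cos (repr y + ratr r).
  by rewrite /s addrAC (periodic_intr _ _ (@cosD2pi R)).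
have h0 : 0 <= `|s + ratr r| by [].
have hpi : `|s + ratr r| <= pi by rewrite /s ler_norml; apply/andP; split; lra.
have hd : `|s + ratr r| < d / 2.
  rewrite ltNge; apply/negP => hd.
  have : cos (d / 2) < cos `|s + ratr r| by rewrite cos_norm cs (lt_trans b1).
  by apply/negP; rewrite -leNgt; apply: ler_cos => //; lra.
have h1 : `|- t0 - ratr r| <= d / 4 by rewrite ler_norml; apply/andP; split; lra.
apply: (@lt_le_trans _ _ d) => //.
rewrite distrC -(subrK (ratr r) (- t0)) addrA addrAC.
apply: (le_lt_trans (ler_normD _ _)); lra.
Qed.

End CircleBasis.

(** * Charges with decaying coefficients vanish on the limit set *)

Section MeasuresOnLimitSet.
Context {R : realType}.
Let T := borel_circle R.
Implicit Types (m : {finite_measure set T -> \bar R}) (nu : {charge set T -> \bar R})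
  (g : T -> R) (A : set T).

Lemma borel_open (U : set (circle R)) : open U -> measurable (U : set T).
Proof. by move=> oU; apply: sub_sigma_algebra. Qed.

Lemma Rintegral_indic m A : measurable A -> \int[m]_x \1_A x = fine (m A) :> R.
Proof. by move=> mA; rewrite /Rintegral integral_indic// setIT. Qed.

Lemma Rintegral_null m A g : measurable A -> m A = 0%E -> bounded_measurable g ->
  (forall x, ~ A x -> g x = 0) -> \int[m]_x g x = 0.
Proof.
move=> mA mA0 bg gA; have [_ [b gb]] := bg.
have bA := @bounded_measurable_indic _ T R A mA.
have ig h : bounded_measurable h -> m.-integrable setT (EFin \o h).
  exact: bounded_measurable_integrable.
apply/eqP; rewrite -normr_le0; apply: (@le_trans _ _ (\int[m]_x (b * \1_A x))).
  apply: (le_trans (le_normr_Rintegral _ _)) => //; first exact: ig.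
  apply: le_Rintegral => //.
  - by apply: ig; exact: bounded_measurable_norm.
  - by apply: ig; apply: bounded_measurableM => //; exact: bounded_measurable_cst.
  - move=> x _; rewrite indicE; have [Ax|nA] := pselect (A x).
      by rewrite mem_set// mulr1.
    by rewrite memNset// mulr0 gA// normr0.
by rewrite RintegralZl//; [rewrite Rintegral_indic// mA0 mulr0 | exact: ig].
Qed.

Lemma multiplier_borel m1 m2 A : measurable A -> multiplier m1 m2 \1_A.
Proof.
suff h : measurable `<=` [set B : set T | multiplier m1 m2 \1_B] by move/h.
have sB := sigma_algebra_multiplier m1 m2.
apply: smallest_sub => // U oU /=.
have -> : U = \bigcup_n (if `[< rational_arc n `<=` U >] then rational_arc n else set0).
  apply/seteqP; split=> [x Ux|x [n _]].
    have [n nx nU] := rational_arc_basis oU Ux.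
    by exists n => //; rewrite asboolT.
  by case: asboolP => // nU; exact: nU.
have [s0 _ sU] := sB; apply: sU => n.
case: asboolP => [_|_]; last exact: s0.
rewrite /rational_arc; case: unpickle => [[r b]|]; last exact: s0.
by case: ifP => [b1|_]; [exact: multiplier_arc | exact: s0].
Qed.

Lemma limit_set_null m (c : R) (N : nat -> nat) : 0 < c -> (forall k, 0 < N k)%N ->
  \int[m]_x cwave n%:Z 0 x @[n --> \oo] --> (0 : R) ->
  m (~` limit_set c N) = 0%E -> m setT = 0%E.
Proof.
move=> c0 N0 mw mK.
have mcK : measurable (~` limit_set c N : set T).
  by apply: borel_open; apply: closed_openC; exact: closed_limit_set.
have ig h : bounded_measurable h -> m.-integrable setT (EFin \o h).
  exact: bounded_measurable_integrable.
have bcst a := @bounded_measurable_cst _ T R a.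
have bw n := @bounded_measurable_cwave R n 0.
set M := fine (m setT); have M0 : 0 <= M by exact: fine_ge0.
suff h e : 0 < e -> c * M <= e.
  suff M00 : M = 0 by rewrite -[LHS]fineK ?fin_num_measure// -/M M00.
  apply/eqP; rewrite eq_le M0 andbT -(pmulr_rle0 _ c0); apply/ler_addgt0Pl => e e0.
  by rewrite addr0; exact: h.
move=> e0; have [k _ /(_ _) hk] := cvgr_dist_le _ _ mw _ e0.
have NR : 0 < (N k)%:R :> R by rewrite ltr0n.
rewrite -(ler_pM2r NR).
pose S x : R := \sum_(j < N k) cwave (k.+1 * 5 ^ j)%N 0 x.
have bS : bounded_measurable (S : T -> R).
  by apply: bounded_measurable_sum => j; exact: bw.
have S_upper : \int[m]_x S x <= e * (N k)%:R.
  have -> : \int[m]_x S x = \sum_(j < N k) \int[m]_x cwave (k.+1 * 5 ^ j)%N 0 x.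
    by rewrite /S Rintegral_sum// => j; exact: bw.
  apply: (@le_trans _ _ (\sum_(j < N k) e)).
    apply: ler_sum => j _; apply: (le_trans (ler_norm _)).
    have kj : (k <= k.+1 * 5 ^ j)%N by rewrite ltnW// leq_pmulr// expn_gt0.
    by have := hk _ kj; rewrite sub0r normrN.
  by rewrite sumr_const card_ord -[e *+ _]mulr_natr.
apply: le_trans S_upper.
(* Off the limit set only S >= - N is known; subtracting B lowers c N to exactly - N there, at no
   cost in the integral. *)
pose B := c * (N k)%:R + (N k)%:R.
have low x : c * (N k)%:R + - B * \1_(~` limit_set c N) x <= S x.
  have [xK|xK] := pselect (limit_set c N x).
    by rewrite indicE memNset ?mulr0 ?addr0; [exact: xK | apply].
  rewrite indicE mem_set// mulr1 /B opprD addNKr.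
  rewrite lerNl; apply: (le_trans (ler_norm _)); rewrite normrN.
  apply: (le_trans (ler_norm_sum _ _ _)).
  apply: (@le_trans _ _ (\sum_(j < N k) 1)).
    by apply: ler_sum => j _; exact: normr_wave.
  by rewrite sumr_const card_ord.
have bind : bounded_measurable (\1_(~` limit_set c N) : T -> R).
  exact: bounded_measurable_indic.
have -> : c * M * (N k)%:R =
    \int[m]_x (c * (N k)%:R + - B * \1_(~` limit_set c N) x).
  rewrite RintegralD//; [|exact: ig|by apply: ig; exact: bounded_measurableM].
  rewrite Rintegral_cst// RintegralZl//; last exact: ig.
  by rewrite Rintegral_indic// mK mulr0 addr0 mulrAC.
apply: le_Rintegral => //; [apply: ig | exact: ig].
by apply: bounded_measurableD => //; exact: bounded_measurableM.
Qed.

Lemma charge_integralE nu g : charge_integral nu g =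
  signed_integral (jordan_pos (projT2 (hahn_pair nu)))
    (jordan_neg (projT2 (hahn_pair nu))) g.
Proof. by []. Qed.

Definition null_near nu (x : circle R) : Prop :=
  exists U : set (circle R), [/\ open U, U x &
    forall A, measurable A -> A `<=` U -> nu A = 0%E].

(* The Hahn sets are legitimate multipliers, so the two Jordan parts inherit
   the decay of the coefficients separately. *)
Lemma charge_limit_set_null nu (c : R) (N : nat -> nat) A : 0 < c ->
  (forall k, 0 < N k)%N ->
  (forall a, charge_integral nu (cwave n%:Z a) @[n --> \oo] --> (0 : R)) ->
  (forall x, ~ limit_set c N x -> null_near nu x) ->
  measurable A -> nu A = 0%E.
Proof.
move=> c0 N0 wnu Knull mA.
have [[mP posP] [mN negN] PUN PIN] := projT2 (hahn_pair nu).
set PN := projT1 (hahn_pair nu) in mP posP mN negN PUN PIN.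
pose m1 := jordan_pos (projT2 (hahn_pair nu)).
pose m2 := jordan_neg (projT2 (hahn_pair nu)).
have m1E B : measurable B -> m1 B = nu (B `&` PN.1).
  by move=> mB; rewrite /m1 jordan_posE cjordan_posE /crestr0 mem_set// /crestr.
have m2E B : measurable B -> m2 B = (- nu (B `&` PN.2))%E.
  by move=> mB; rewrite /m2 jordan_negE cjordan_negE /crestr0 mem_set// /crestr.
have null_of B : measurable B -> (forall A, measurable A -> A `<=` B -> nu A = 0%E) ->
    m1 B = 0%E /\ m2 B = 0%E.
  move=> mB h; rewrite m1E// m2E// !h ?oppe0//; try exact: measurableI.
pose arc n : set T := rational_arc n.
(* Retaining the null arcs of the base replaces a possibly uncountable cover of the complement by a
   countable one. *)
pose small n := forall A, measurable A -> A `<=` arc n -> nu A = 0%E.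
pose F n : set T := if `[< small n >] then arc n else set0.
have mF n : measurable (F n).
  rewrite /F; case: asboolP => _; last exact: measurable0.
  by apply: borel_open; exact: open_rational_arc.
have KF : (~` limit_set c N : set T) `<=` \bigcup_n F n.
  move=> x /Knull[U [oU Ux Unull]]; have [n nx nU] := rational_arc_basis oU Ux.
  exists n => //; rewrite /F asboolT// => B mB Bn.
  by apply: Unull => //; exact: subset_trans nU.
have mcK : measurable (~` limit_set c N : set T).
  by apply: borel_open; apply: closed_openC; exact: closed_limit_set.
have F0 n : m1 (F n) = 0%E /\ m2 (F n) = 0%E.
  rewrite /F; case: asboolP => [sn|_]; last by split; exact: measure0.
  by apply: null_of => //; apply: borel_open; exact: open_rational_arc.
have mK0 m : (forall n, m (F n) = 0%E) -> m (~` limit_set c N) = 0%E.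
  move=> mFn; apply: measure_negligible => //.
  apply: (negligibleS KF); apply: negligible_bigcup => n.
  by exists (F n); split; [exact: mF | exact: mFn |].
have bw n := @bounded_measurable_cwave R n 0.
have van : coefs_vanish m1 m2 (fun=> 1).
  split=> [|a]; first exact: bounded_measurable_cst.
  rewrite (_ : (fun n : nat => _) = (fun n : nat => charge_integral nu (cwave n%:Z a))).
    exact: wnu.
  apply/funext => n; rewrite charge_integralE -/m1 -/m2.
  by congr signed_integral; apply/funext => x; rewrite mul1r.
have restrict m (D : set T) n : measurable D -> m (~` D) = 0%E ->
    \int[m]_x (\1_D x * 1 * cwave n 0 x) = \int[m]_x cwave n 0 x.
  move=> mD mD0; have bD := @bounded_measurable_indic _ T R D mD.
  have b1 : bounded_measurable (fun x : T => \1_D x * 1 * cwave n 0 x : R).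
    apply: bounded_measurableM => //.
    by apply: bounded_measurableM => //; exact: bounded_measurable_cst.
  have bi g := @bounded_measurable_integrable _ T R m g.
  apply/eqP; rewrite -subr_eq0 -RintegralB//; [|exact: bi..].
  apply/eqP; apply: (Rintegral_null (measurableC mD) mD0).
    apply: bounded_measurableD => //.
    have := bounded_measurableM (bounded_measurable_cst T (-1)) (bw n).
    by congr bounded_measurable; apply/funext => x; rewrite mulN1r.
  by move=> x /contrapT Dx; rewrite indicE mem_set// !mul1r subrr.
have vanish m (D : set T) n : measurable D -> m D = 0%E ->
    \int[m]_x (\1_D x * 1 * cwave n 0 x) = 0.
  move=> mD mD0; apply: (Rintegral_null mD mD0) => [|x Dx].
    apply: bounded_measurableM => //; apply: bounded_measurableM.
      exact: bounded_measurable_indic.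
    exact: bounded_measurable_cst.
  by rewrite indicE memNset// !mul0r.
have nu0 : nu set0 = 0%E by exact: charge0.
(* Each Jordan part is carried by its own Hahn set, which is null for the other part; the indicator
   of that set thus isolates one positive measure. *)
have m1P : m1 (~` PN.1) = 0%E by rewrite m1E ?setICl//; exact: measurableC.
have m2P : m2 PN.1 = 0%E by rewrite m2E// PIN nu0 oppe0.
have m2N : m2 (~` PN.2) = 0%E.
  by rewrite m2E ?setICl ?nu0 ?oppe0//; exact: measurableC.
have m1N : m1 PN.2 = 0%E by rewrite m1E// setIC PIN.
have m1T : m1 setT = 0%E.
  apply: (limit_set_null c0 N0); last by apply: mK0 => n; case: (F0 n).
  have [_ /(_ 0)] := @multiplier_borel m1 m2 _ mP _ van.
  apply: cvg_trans; apply: near_eq_cvg; near=> n; rewrite /signed_integral.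
  by rewrite (restrict m1 _ _ mP m1P) (vanish m2 _ _ mP m2P) subr0.
have m2T : m2 setT = 0%E.
  apply: (limit_set_null c0 N0); last by apply: mK0 => n; case: (F0 n).
  have [_ /(_ 0) h] := @multiplier_borel m1 m2 _ mN _ van.
  have : - signed_integral m1 m2 (fun x => \1_(PN.2) x * 1 * cwave n%:Z 0 x)
      @[n --> \oo] --> (- 0 : R) by apply: cvgN.
  rewrite oppr0; apply: cvg_trans; apply: near_eq_cvg.
  near=> n; rewrite /signed_integral.
  by rewrite /= (restrict m2 _ _ mN m2N) (vanish m1 _ _ mN m1N) sub0r opprK.
have sub m : m setT = 0%E -> m A = 0%E.
  move=> mT; apply/eqP; rewrite -measure_le0 -mT; apply: le_measure; rewrite ?inE//.
have m1A : m1 A = 0%E by exact: sub.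
have m2A : m2 A = 0%E by exact: sub.
transitivity (m1 A + - m2 A)%E; last by rewrite m1A m2A oppe0 adde0.
by rewrite (jordan_decomp (projT2 (hahn_pair nu)) mA) /cadd/= cscaleN1.
Unshelve. all: by end_near. Qed.

End MeasuresOnLimitSet.

(** * From summable complex coefficients to decay for both real charges *)

Section CoefficientDecay.
Context {R : realType}.
Local Open Scope complex_scope.
Local Open Scope ring_scope.
Let T := borel_circle R.
Implicit Types (mu : complex_measure R) (nu : {charge set T -> \bar R}).

Lemma ell_q_cvg0 (q : R) (a : int -> R[i]) (h : nat -> int) : 0 < q -> injective h ->
  ell_q q a -> normc (a (h n)) @[n --> \oo] --> (0 : R).
Proof.
move=> q0 hinj aq; pose u n := normc (a (h n)) `^ q.
have u0 n : 0 <= u n by exact: powR_ge0.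
have usum n : ((\sum_(i < n) u i)%:E <= \esum_(m in [set: int]) (normc (a m) `^ q)%:E)%E.
  apply: esum_ge; exists (h @` `I_n).
    by split=> //; apply: finite_image; exact: finite_II.
  rewrite fsbig_image; last by move=> i j _ _; exact: hinj.
  by rewrite -fsbig_ord sumEFin.
have ucvg : u n @[n --> \oo] --> (0 : R).
  apply: cvg_series_cvg_0; apply: nondecreasing_is_cvgn.
    by apply: nondecreasing_series => n _ _; exact: u0.
  exists (fine (\esum_(m in [set: int]) (normc (a m) `^ q)%:E)) => _ [n _ <-].
  rewrite /series/= big_mkord -lee_fin fineK; first exact: usum.
  by rewrite fin_numElt aq andbT; apply: lt_le_trans (usum 0%N); rewrite ltNyr.
have nc0 n : 0 <= normc (a (h n)) by case: (a (h n)) => x y; exact: sqrtr_ge0.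
apply/cvgrPdist_le => e e0; have eq0 : 0 < e `^ q by rewrite powR_gt0.
have [n0 _ hn] := cvgr_dist_lt _ _ ucvg _ eq0.
exists n0 => // n /= n0n; rewrite sub0r normrN ger0_norm//.
have := hn n n0n; rewrite /= sub0r normrN ger0_norm// => h1.
rewrite leNgt; apply/negP => h2; move: h1; rewrite ltNge => /negP; apply.
by apply: ge0_ler_powR; rewrite ?nnegrE; try exact: ltW.
Qed.

Let bw n (a : R) := @bounded_measurable_cwave R n a.

Lemma charge_integral_cwave_phase nu n (a : R) :
  charge_integral nu (cwave n a) = cos a * charge_integral nu (cwave n 0) +
    sin a * charge_integral nu (cwave n (pi / 2)).
Proof.
have bm := @bounded_measurableM _ T R.
have bc := @bounded_measurable_cst _ T R.
rewrite !charge_integralE -!signed_integralZ -?signed_integralD; try exact: bw.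
- congr signed_integral; apply/funext => x.
  rewrite /cwave /wave addr0 cosDpihalf cosD; ring.
- by apply: bm; [exact: bc | exact: bw].
- by apply: bm; [exact: bc | exact: bw].
Qed.

Lemma charge_integral_cwaveN nu n :
  charge_integral nu (cwave (- n) 0) = charge_integral nu (cwave n 0) /\
  charge_integral nu (cwave (- n) (pi / 2)) = - charge_integral nu (cwave n (pi / 2)).
Proof.
split.
  congr charge_integral; apply/funext => x.
  by rewrite /cwave /wave !addr0 mulrNz mulNr cosN.
rewrite !charge_integralE -[RHS]mulN1r -signed_integralZ; last exact: bw.
congr signed_integral; apply/funext => x.
by rewrite /cwave /wave !cosDpihalf mulrNz mulNr sinN mulN1r.
Qed.

Lemma cmeas_fourierE mu n : cmeas_fourier mu n =
  ((2 * pi)^-1 * (charge_integral (cmeas_Re mu) (cwave n 0) -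
                  charge_integral (cmeas_Im mu) (cwave n (pi / 2)))) +i*
  ((2 * pi)^-1 * (charge_integral (cmeas_Re mu) (cwave n (pi / 2)) +
                  charge_integral (cmeas_Im mu) (cwave n 0))).
Proof.
have eR : (fun x => complex.Re (expit (- n) x)) = (cwave n 0 : T -> R).
  by apply/funext => x; rewrite /= /cwave /wave mulrNz mulNr cosN addr0.
have eI : (fun x => complex.Im (expit (- n) x)) = (cwave n (pi / 2) : T -> R).
  by apply/funext => x; rewrite /= /cwave /wave mulrNz mulNr sinN cosDpihalf.
rewrite /cmeas_fourier /cmeas_integral eR eI.
by congr (_ +i* _); rewrite /= !mul0r ?subr0 ?addr0.
Qed.

Lemma cmeas_fourierNE mu n : cmeas_fourier mu (- n) =
  ((2 * pi)^-1 * (charge_integral (cmeas_Re mu) (cwave n 0) +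
                  charge_integral (cmeas_Im mu) (cwave n (pi / 2)))) +i*
  ((2 * pi)^-1 * (charge_integral (cmeas_Im mu) (cwave n 0) -
                  charge_integral (cmeas_Re mu) (cwave n (pi / 2)))).
Proof.
rewrite cmeas_fourierE; have [-> ->] := charge_integral_cwaveN (cmeas_Re mu) n.
have [-> ->] := charge_integral_cwaveN (cmeas_Im mu) n.
by rewrite opprK [X in _ +i* (_ * X)]addrC.
Qed.

(** A coefficient mixes the integrals against [cmeas_Re mu] and [cmeas_Im mu]. Passing from n to - n
    flips only the sine integrals, so both families of frequencies together separate the two
    charges. *)
Lemma cmeas_charge_cvg0 mu (q : R) : 0 < q -> ell_q q (cmeas_fourier mu) ->
  forall a : R,
    charge_integral (cmeas_Re mu) (cwave n%:Z a) @[n --> \oo] --> (0 : R) /\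
    charge_integral (cmeas_Im mu) (cwave n%:Z a) @[n --> \oo] --> (0 : R).
Proof.
move=> q0 muq.
pose P n := complex.Re (cmeas_fourier mu n); pose Q n := complex.Im (cmeas_fourier mu n).
have dom (u : nat -> R) (h : nat -> int) : injective h ->
    (forall n, `|u n| <= normc (cmeas_fourier mu (h n))) -> u n @[n --> \oo] --> (0 : R).
  move=> hinj uh; apply/cvgrPdist_le => e e0.
  have [n0 _ hn] := cvgr_dist_le _ _ (ell_q_cvg0 q0 hinj muq) _ e0.
  exists n0 => // n /= /hn; rewrite !sub0r !normrN => h1.
  by apply: (le_trans (uh n)); exact: le_trans (ler_norm _) h1.
have injp : injective (fun n : nat => n%:Z) by move=> i j [].
have injn : injective (fun n : nat => - n%:Z) by move=> i j /oppr_inj [].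
have P1 : P n%:Z @[n --> \oo] --> (0 : R) by apply: (dom _ _ injp) => n; exact: norm_Re_le_normc.
have P2 : P (- n%:Z) @[n --> \oo] --> (0 : R) by apply: (dom _ _ injn) => n; exact: norm_Re_le_normc.
have Q1 : Q n%:Z @[n --> \oo] --> (0 : R) by apply: (dom _ _ injp) => n; exact: norm_Im_le_normc.
have Q2 : Q (- n%:Z) @[n --> \oo] --> (0 : R) by apply: (dom _ _ injn) => n; exact: norm_Im_le_normc.
have comb (u v w : nat -> R) (c d : R) : u n @[n --> \oo] --> (0 : R) ->
    v n @[n --> \oo] --> (0 : R) -> (forall n, w n = c * u n + d * v n) ->
    w n @[n --> \oo] --> (0 : R).
  move=> cu cv wE; have -> : w = fun n => c * u n + d * v n by apply/funext.
  have -> : 0 = c * 0 + d * 0 :> R by rewrite !mulr0 addr0.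
  by apply: cvgD; apply: cvgMl_tmp.
have p0 : pi != 0 :> R by rewrite gt_eqF ?pi_gt0.
have half (p x y : R) : p != 0 -> (x = p * ((2 * p)^-1 * (x - y)) + p * ((2 * p)^-1 * (x + y))) *
    (y = - p * ((2 * p)^-1 * (x - y)) + p * ((2 * p)^-1 * (x + y))).
  by move=> pn0; split; field.
have ReC : charge_integral (cmeas_Re mu) (cwave n%:Z 0) @[n --> \oo] --> (0 : R).
  apply: (comb _ _ _ pi pi P1 P2) => n; rewrite /P cmeas_fourierE cmeas_fourierNE /=.
  exact: (half _ _ _ p0).1.
have ImS : charge_integral (cmeas_Im mu) (cwave n%:Z (pi / 2)) @[n --> \oo] --> (0 : R).
  apply: (comb _ _ _ (- pi) pi P1 P2) => n; rewrite /P cmeas_fourierE cmeas_fourierNE /=.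
  exact: (half _ _ _ p0).2.
have ReS : charge_integral (cmeas_Re mu) (cwave n%:Z (pi / 2)) @[n --> \oo] --> (0 : R).
  apply: (comb _ _ _ pi (- pi) Q1 Q2) => n; rewrite /Q cmeas_fourierE cmeas_fourierNE /=.
  by rewrite addrC [X in _ + _ * (_ * X)]addrC; exact: (half _ _ _ p0).2.
have ImC : charge_integral (cmeas_Im mu) (cwave n%:Z 0) @[n --> \oo] --> (0 : R).
  apply: (comb _ _ _ pi pi Q1 Q2) => n; rewrite /Q cmeas_fourierE cmeas_fourierNE /=.
  by rewrite addrC [X in _ + _ * (_ * X)]addrC; exact: (half _ _ _ p0).1.
move=> a; split.
  by apply: (comb _ _ _ (cos a) (sin a) ReC ReS) => n; exact: charge_integral_cwave_phase.
by apply: (comb _ _ _ (cos a) (sin a) ImC ImS) => n; exact: charge_integral_cwave_phase.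
Qed.

End CoefficientDecay.

Theorem theorem2p1 (R : realType) (q : R) (hq : 2 < q) :
  exists K : set (circle R),
    [/\ compact K,
        exists S : schwartz_distribution R,
          [/\ dist_nonzero S, dist_supp S `<=` K & ell_q q (dist_fourier S)]
      & ~ exists mu : complex_measure R,
          [/\ cmeas_nonzero mu, cmeas_supp mu `<=` K
            & ell_q q (cmeas_fourier mu)]].
Proof.
have [c [C [N [f [c0 [N0 Cf] van [f0 inc] coef]]]]] := construction_sequence hq.
exists (limit_set c N); split.
- exact: limit_set_compact.
- exists (limit_distribution Cf f0 inc); split.
  + exact: limit_distribution_nonzero.
  + exact: limit_distribution_supp van _.
  + exact: (limit_distribution_ell_q hq _ _ _ coef).
case=> mu [[A mA /eqP muA] supp_mu mu_q]; apply: muA.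
have q0 : 0 < q by lra.
have decay := cmeas_charge_cvg0 q0 mu_q.
have null x : ~ limit_set c N x -> null_near (cmeas_Re mu) x /\ null_near (cmeas_Im mu) x.
  move=> Kx; have : ~ cmeas_supp mu x by move=> /supp_mu.
  (* Off the support some neighbourhood has all its Borel subsets of complex measure 0, so the same
     neighbourhood serves both parts. *)
  rewrite /cmeas_supp /= -existsNP => -[U] /not_implyP[oU] /not_implyP[Ux] nA.
  have muU (B : set (borel_circle R)) : measurable B -> B `<=` U -> cmeas mu B = 0.
    by move=> mB BU; apply/eqP; apply: contrapT => /negP B0; apply: nA; exists B.
  by split; exists U; split=> // B mB BU; have /eqP := muU B mB BU;
    rewrite eq_complex /= => /andP[/eqP reB /eqP imB];
    rewrite -[LHS]fineK ?fin_num_measure// ?reB ?imB.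
have Re0 := charge_limit_set_null c0 N0 (fun a => (decay a).1) (fun x Kx => (null x Kx).1) mA.
have Im0 := charge_limit_set_null c0 N0 (fun a => (decay a).2) (fun x Kx => (null x Kx).2) mA.
by rewrite /cmeas Re0 Im0.
Qed.
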